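(* Assume Assumption A and the clustering setup. Consider the reduced networked system $\hat\Sigma$: $\dot\xi=(I_{\bar n-1}\otimes A-\hat L\otimes BC)\xi+(\hat G\otimes B)u$, $\hat y=(\hat H\otimes C)\xi$, where $\hat L=W^\top LV$, $\hat G=W^\top G$, $\hat H=HV$, $\xi=(\xi_1,\dots,\xi_{\bar n-1})$, $\xi_p\in\mathbb{R}^n$. Then for $u\equiv0$ every solution satisfies $\lim_{t\to\infty}(\xi_p(t)-\xi_q(t))=0$ for all $p,q\in\{1,\dots,\bar n-1\}$.
   Context: Subsystem data: $Q=Q^\top\succ0$, $J=-J^\top$, $R=R^\top\succeq0$ in $\mathbb{R}^{n\times n}$, $B\in\mathbb{R}^{n\times m}$, $A=(J-R)Q$, $C=B^\top Q$, with $(A,B,C)$ a minimal realization. Weights $w_{ij}\ge0$ ($i\ne j\in\{1,\dots,\bar n\}$, $\bar n\ge3$); $L_{ij}=-w_{ij}$ for $i\neq j$, $L_{ii}=\sum_{j\ne i}w_{ij}$; $G\in\mathbb{R}^{\bar n\times\bar m}$, $H\in\mathbb{R}^{\bar p\times\bar n}$. The directed graph $\mathcal G$ has an arc $(i,j)$ iff $w_{ji}>0$; the underlying undirected graph $\mathcal G_u$ has an edge between $i$ and $j$ iff $w_{ij}+w_{ji}>0$. A directed rooted spanning tree is a subgraph that is a directed tree containing all vertices in which every vertex except one root has exactly one incoming arc. Assumption A: (i) $\mathcal G_u$ is a tree; (ii) $\mathcal G$ contains a directed rooted spanning tree. Clustering setup: vertices numbered so that vertices $i=\bar n-1$ and $j=\bar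 n$ are adjacent in $\mathcal G_u$, and $V=\begin{bmatrix}I_{\bar n-2}&0\\0&1\\0&1\end{bmatrix}$, $W=\begin{bmatrix}I_{\bar n-2}&0\\0&\frac{w_{ji}}{w_{ij}+w_{ji}}\\0&\frac{w_{ij}}{w_{ij}+w_{ji}}\end{bmatrix}$. $\otimes$ is the Kronecker product. *)

(* Defs.v *)
From Stdlib Require Import Reals Lra List.
Open Scope R_scope.

(* Conventions: vectors are nat -> R, matrices nat -> nat -> R; the
   dimensions are carried separately and only indices below them matter.
   Vertices of the graph are numbered 0 .. nbar-1 (paper: 1 .. nbar). *)

Fixpoint fsum (k : nat) (f : nat -> R) : R :=
  match k with
  | O => 0
  | S k' => fsum k' f + f k'
  end.

Definition mat := nat -> nat -> R.

Definition mmul (k : nat) (M N : mat) : mat :=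
  fun i j => fsum k (fun l => M i l * N l j).

Definition madd (M N : mat) : mat := fun i j => M i j + N i j.
Definition msub (M N : mat) : mat := fun i j => M i j - N i j.
Definition mtr (M : mat) : mat := fun i j => M j i.
Definition idm : mat := fun i j => if Nat.eq_dec i j then 1 else 0.

Fixpoint mpow (n : nat) (M : mat) (k : nat) : mat :=
  match k with
  | O => idm
  | S k' => mmul n M (mpow n M k')
  end.

Definition symmetric (n : nat) (M : mat) : Prop :=
  forall i j, (i < n)%nat -> (j < n)%nat -> M i j = M j i.
Definition skew (n : nat) (M : mat) : Prop :=
  forall i j, (i < n)%nat -> (j < n)%nat -> M i j = - M j i.
Definition qform (n : nat) (M : mat) (x : nat -> R) : R :=
  fsum n (fun i => fsum n (fun j => x i * M i j * x j)).
Definition pos_def (n : nat) (M : mat) : Prop :=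
  symmetric n M /\
  forall x : nat -> R, (exists i, (i < n)%nat /\ x i <> 0) -> qform n M x > 0.
Definition pos_semidef (n : nat) (M : mat) : Prop :=
  symmetric n M /\ forall x : nat -> R, qform n M x >= 0.

(* Kalman rank condition rank [B AB ... A^(n-1)B] = n, written as
   "the controllability matrix has trivial left kernel". *)
Definition controllable (n m : nat) (A B : mat) : Prop :=
  forall v : nat -> R,
    (forall k c, (k < n)%nat -> (c < m)%nat ->
       fsum n (fun r => v r * mmul n (mpow n A k) B r c) = 0) ->
    forall r, (r < n)%nat -> v r = 0.
(* rank [C; CA; ...; CA^(n-1)] = n: trivial right kernel; C is p x n. *)
Definition observable (n p : nat) (A C : mat) : Prop :=
  forall x : nat -> R,
    (forall k c, (k < n)%nat -> (c < p)%nat ->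
       fsum n (fun r => mmul n C (mpow n A k) c r * x r) = 0) ->
    forall r, (r < n)%nat -> x r = 0.
Definition minimal_realization (n m p : nat) (A B C : mat) : Prop :=
  controllable n m A B /\ observable n p A C.

Inductive reach (e : nat -> nat -> Prop) : nat -> nat -> Prop :=
| reach_refl : forall a, reach e a a
| reach_step : forall a b c, reach e a b -> e b c -> reach e a c.

Fixpoint chain (e : nat -> nat -> Prop) (x : nat) (l : list nat) : Prop :=
  match l with
  | nil => True
  | y :: l' => e x y /\ chain e y l'
  end.

Definition has_cycle (N : nat) (e : nat -> nat -> Prop) : Prop :=
  exists (v0 : nat) (l : list nat),
    (2 <= length l)%nat /\ NoDup (v0 :: l) /\
    (forall v, In v (v0 :: l) -> (v < N)%nat) /\
    chain e v0 (l ++ v0 :: nil).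

(* e is a symmetric irreflexive relation on 0..N-1: a tree = connected and
   acyclic *)
Definition is_tree (N : nat) (e : nat -> nat -> Prop) : Prop :=
  (forall a b, (a < N)%nat -> (b < N)%nat -> reach e a b) /\ ~ has_cycle N e.

Definition und_edge (N : nat) (w : mat) (i j : nat) : Prop :=
  (i < N)%nat /\ (j < N)%nat /\ i <> j /\ w i j + w j i > 0.

Definition arc (N : nat) (w : mat) (i j : nat) : Prop :=
  (i < N)%nat /\ (j < N)%nat /\ i <> j /\ w j i > 0.

Definition has_rooted_spanning_tree (N : nat) (w : mat) : Prop :=
  exists (T : nat -> nat -> Prop) (r : nat),
    (r < N)%nat /\
    (forall i j, T i j -> arc N w i j) /\
    (forall j, (j < N)%nat -> j <> r -> exists! i, T i j) /\
    (forall i, ~ T i r) /\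
    is_tree N (fun i j => T i j \/ T j i).

Definition assumption_A (N : nat) (w : mat) : Prop :=
  is_tree N (und_edge N w) /\ has_rooted_spanning_tree N w.

Definition laplacian (N : nat) (w : mat) : mat :=
  fun i j => if Nat.eq_dec i j
             then fsum N (fun k => if Nat.eq_dec k i then 0 else w i k)
             else - w i j.

(* clustering matrices V, W (nbar x (nbar-1)); with 0-based indexing the
   clustered vertices are i = nbar-2, j = nbar-1, merged into column nbar-2 *)
Definition Vmat (N : nat) : mat :=
  fun r c => if Nat.ltb r (N - 2) then (if Nat.eq_dec r c then 1 else 0)
             else (if Nat.eq_dec c (N - 2) then 1 else 0).

Definition Wmat (N : nat) (w : mat) : mat :=
  fun r c =>
    let i := (N - 2)%nat in let j := (N - 1)%nat in
    if Nat.ltb r (N - 2) then (if Nat.eq_dec r c then 1 else 0)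
    else if Nat.eq_dec c (N - 2) then
           (if Nat.eq_dec r i then w j i / (w i j + w j i)
            else w i j / (w i j + w j i))
         else 0.

Definition Lhat (N : nat) (w : mat) : mat :=
  mmul N (mtr (Wmat N w)) (mmul N (laplacian N w) (Vmat N)).
Definition Ghat (N : nat) (w G : mat) : mat := mmul N (mtr (Wmat N w)) G.

(* Main.v *)
(** For each output channel, let [x p] be the output of cluster [p] and [y = Lhat x].
    On a rooted tree, with [e c = x c - x (par c)], there are weights [kap c > 0] such that
    [sum kap c * e c * (y c - y (par c)) >= c0 * sum kap c * (e c)^2]; they are built from the
    leaves to the root, exactly balancing bidirectional edges and scaling down the subtree
    below a unidirectional one. Since every subsystem is passive with storage [Q], the
    function [V = sum kap c * zeta_c^T Q zeta_c] of the parent differences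
    [zeta_c = xi_c - xi_(par c)] satisfies [V' <= - 2 c0 sum kap c * |C zeta_c|^2]. All signals
    are bounded polynomials in the [zeta_c], so [V'] tends to 0 (Landau-Hadamard), hence so do
    the outputs [C zeta_c]; the functionals [v] with [v . zeta_c -> 0] form an [A^T]-invariant
    subspace containing the rows of [C], so observability gives [zeta_c -> 0]. Contracting an
    edge of the tree leaves a rooted tree. *)
Require Import Defs.
From Stdlib Require Import Reals Lra Lia List Classical.
Open Scope R_scope.

(** * Finite sums and subspaces *)

Lemma fsum_ext (k : nat) (f g : nat -> R) :
  (forall i, (i < k)%nat -> f i = g i) -> fsum k f = fsum k g.
Proof.
  induction k as [|k IH]; intros H; simpl; [reflexivity|].
  rewrite IH, (H k) by (intros; try apply H; lia); reflexivity.
Qed.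

Lemma fsum_plus (k : nat) (f g : nat -> R) :
  fsum k (fun i => f i + g i) = fsum k f + fsum k g.
Proof. induction k as [|k IH]; simpl; [ring|rewrite IH; ring]. Qed.

Lemma fsum_minus (k : nat) (f g : nat -> R) :
  fsum k (fun i => f i - g i) = fsum k f - fsum k g.
Proof. induction k as [|k IH]; simpl; [ring|rewrite IH; ring]. Qed.

Lemma fsum_scal (k : nat) (a : R) (f : nat -> R) :
  fsum k (fun i => a * f i) = a * fsum k f.
Proof. induction k as [|k IH]; simpl; [ring|rewrite IH; ring]. Qed.

Lemma fsum_zero (k : nat) (f : nat -> R) :
  (forall i, (i < k)%nat -> f i = 0) -> fsum k f = 0.
Proof.
  induction k as [|k IH]; intros H; simpl; [reflexivity|].
  rewrite IH, (H k) by (intros; try apply H; lia); ring.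
Qed.

Lemma fsum_swap (k l : nat) (f : nat -> nat -> R) :
  fsum k (fun i => fsum l (fun j => f i j)) =
  fsum l (fun j => fsum k (fun i => f i j)).
Proof.
  induction k as [|k IH]; simpl.
  - symmetry; now apply fsum_zero.
  - now rewrite IH, <- fsum_plus.
Qed.

Lemma fsum_le (k : nat) (f g : nat -> R) :
  (forall i, (i < k)%nat -> f i <= g i) -> fsum k f <= fsum k g.
Proof.
  induction k as [|k IH]; intros H; simpl; [lra|].
  apply Rplus_le_compat; [apply IH; intros; apply H|apply H]; lia.
Qed.

Lemma fsum_nonneg (k : nat) (f : nat -> R) :
  (forall i, (i < k)%nat -> 0 <= f i) -> 0 <= fsum k f.
Proof.
  intros H; rewrite <- (fsum_zero k (fun _ => 0)) by reflexivity.
  now apply fsum_le.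
Qed.

Lemma fsum_term_le (k j : nat) (f : nat -> R) :
  (forall i, (i < k)%nat -> 0 <= f i) -> (j < k)%nat -> f j <= fsum k f.
Proof.
  induction k as [|k IH]; intros H Hj; [lia|]; simpl.
  assert (0 <= f k) by (apply H; lia).
  assert (0 <= fsum k f) by (apply fsum_nonneg; intros; apply H; lia).
  destruct (Nat.eq_dec j k) as [->|]; [lra|].
  assert (f j <= fsum k f) by (apply IH; [intros; apply H|]; lia); lra.
Qed.

Lemma fsum_single (k j : nat) (f : nat -> R) :
  (j < k)%nat -> (forall i, (i < k)%nat -> i <> j -> f i = 0) -> fsum k f = f j.
Proof.
  induction k as [|k IH]; intros Hj H; [lia|]; simpl.
  destruct (Nat.eq_dec j k) as [->|].
  - rewrite fsum_zero; [ring|]; intros i Hi; apply H; lia.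
  - rewrite IH, (H k); [ring|lia|lia|lia|intros; apply H; lia].
Qed.

Definition mv (n : nat) (M : mat) (x : nat -> R) : nat -> R :=
  fun i => fsum n (fun l => M i l * x l).

Lemma mv_mmul (n k : nat) (M N : mat) (x : nat -> R) (i : nat) :
  mv n (mmul k M N) x i = mv k M (mv n N x) i.
Proof.
  unfold mv, mmul.
  transitivity (fsum n (fun l => fsum k (fun j => M i j * N j l * x l))).
  - apply fsum_ext; intros l _; rewrite Rmult_comm, <- fsum_scal.
    apply fsum_ext; intros; ring.
  - rewrite fsum_swap; apply fsum_ext; intros j _; rewrite <- fsum_scal.
    apply fsum_ext; intros; ring.
Qed.

Lemma mv_minus (n : nat) (M : mat) (x y : nat -> R) (i : nat) :
  mv n M (fun l => x l - y l) i = mv n M x i - mv n M y i.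
Proof.
  unfold mv; rewrite <- fsum_minus; apply fsum_ext; intros; ring.
Qed.

Lemma dot_mv_tr (n k : nat) (M : mat) (x y : nat -> R) :
  fsum n (fun i => x i * mv k M y i) = fsum k (fun j => mv n (mtr M) x j * y j).
Proof.
  unfold mv, mtr.
  transitivity (fsum n (fun i => fsum k (fun j => M i j * x i * y j))).
  - apply fsum_ext; intros i _; rewrite <- fsum_scal.
    apply fsum_ext; intros; ring.
  - rewrite fsum_swap; apply fsum_ext; intros j _.
    rewrite Rmult_comm, <- fsum_scal; apply fsum_ext; intros; ring.
Qed.

(** Vectors are functions on all of [nat], so the first clause makes membership depend on the
    coordinates below [n] only. *)
Definition subspace (n : nat) (S : (nat -> R) -> Prop) : Prop :=
  (forall v v', (forall i, (i < n)%nat -> v i = v' i) -> S v -> S v') /\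
  (forall v v' a, S v -> S v' -> S (fun i => v i + a * v' i)) /\
  S (fun _ => 0).

(** Induction on [n], eliminating the last coordinate: a member [c] of [S] with [c n <> 0] reduces
    the claim to members whose last coordinate is 0, and without such a [c] the last unit vector
    would annihilate [S]. Boundedness and convergence of all functionals are later proved this
    way. *)
Lemma annihilator_trivial_full (n : nat) (S : (nat -> R) -> Prop) :
  subspace n S ->
  (forall x, (forall v, S v -> fsum n (fun i => v i * x i) = 0) ->
     forall i, (i < n)%nat -> x i = 0) ->
  forall v, S v.
Proof.
  revert S; induction n as [|n IH]; intros S (Hext & Hlin & H0) Hann v.
  { apply (Hext (fun _ => 0)); [intros; lia|exact H0]. }
  destruct (classic (exists c, S c /\ c n <> 0)) as [(c & Sc & Hc)|Hno].
  - pose (S0 := fun u => S (fun i => if Nat.eq_dec i n then 0 else u i)).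
    assert (HS0 : forall u, S0 u).
    { apply IH.
      - split; [|split].
        + intros u u' E Hu; unfold S0 in *; eapply Hext; [|exact Hu].
          intros i Hi; simpl; destruct (Nat.eq_dec i n); [reflexivity|].
          apply E; lia.
        + intros u u' a Hu Hu'; unfold S0 in *.
          eapply Hext; [|exact (Hlin _ _ a Hu Hu')].
          intros i Hi; simpl; destruct (Nat.eq_dec i n); ring.
        + unfold S0; eapply Hext; [|exact H0].
          intros i Hi; simpl; destruct (Nat.eq_dec i n); ring.
      - intros x Hx i Hi.
        (* Extends [x] by the last coordinate that makes it orthogonal to [c]. Orthogonality to any
           [s] in [S] is then tested in [S0], after subtracting a multiple of [c] from [s]. *)
        pose (x' := fun j => if Nat.eq_dec j n
                     then - fsum n (fun j => c j * x j) / c n else x j).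
        assert (E : forall u, fsum n (fun j => u j * x' j)
                              = fsum n (fun j => u j * x j)).
        { intros u; apply fsum_ext; intros j Hj; unfold x'.
          destruct (Nat.eq_dec j n); [lia|reflexivity]. }
        assert (Hx' : forall j, (j < Datatypes.S n)%nat -> x' j = 0).
        { apply Hann; intros s Ss; simpl.
          assert (Hs0 : S0 (fun j => s j + - (s n / c n) * c j)).
          { unfold S0; eapply Hext; [|exact (Hlin _ _ (- (s n / c n)) Ss Sc)].
            intros j Hj; simpl; destruct (Nat.eq_dec j n); [subst; now field|reflexivity]. }
          apply Hx in Hs0.
          rewrite (fsum_ext n _ (fun j => s j * x j + - (s n / c n) * (c j * x j)))
            in Hs0 by (intros; ring).
          rewrite fsum_plus, fsum_scal in Hs0.
          rewrite E; unfold x' at 1; destruct (Nat.eq_dec n n); [|lia].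
          transitivity (fsum n (fun i0 => s i0 * x i0) +
            - (s n / c n) * fsum n (fun i0 => c i0 * x i0)); [now field|exact Hs0]. }
        specialize (Hx' i ltac:(lia)); unfold x' in Hx'.
        destruct (Nat.eq_dec i n); [lia|exact Hx']. }
    eapply Hext;
      [|exact (Hlin _ _ (v n / c n) (HS0 (fun j => v j - v n / c n * c j)) Sc)].
    intros i Hi; simpl; destruct (Nat.eq_dec i n); [subst; now field|ring].
  - exfalso.
    assert (F : (fun i : nat => if Nat.eq_dec i n then 1 else 0) n = 0).
    { apply (Hann (fun i => if Nat.eq_dec i n then 1 else 0)); [|lia]; intros s Ss.
      rewrite (fsum_single _ n); [|lia|].
      - destruct (Nat.eq_dec n n); [|lia].
        destruct (Req_dec (s n) 0) as [->|]; [ring|].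
        exfalso; apply Hno; now exists s.
      - intros i _ Hi; destruct (Nat.eq_dec i n); [lia|ring]. }
    simpl in F; destruct (Nat.eq_dec n n); [lra|lia].
Qed.

(** * Dissipation on a rooted tree *)

(** The strictly decreasing [rank] forces every chain of parents to end at [r] and carries the
    inductions along the tree. The convention [par r = r] makes the difference [x r - x (par r)]
    zero. *)
Definition rooted_tree (K r : nat) (par rank : nat -> nat) : Prop :=
  (r < K)%nat /\ par r = r /\
  (forall p, (p < K)%nat -> (par p < K)%nat) /\
  (forall p, (p < K)%nat -> p <> r -> (rank (par p) < rank p)%nat).

(** Proper descendants, with chains extended at the ancestor's end, so that inversion exhibits the
    child of the ancestor through which the chain passes. *)
Inductive desc (K r : nat) (par : nat -> nat) : nat -> nat -> Prop :=
| desc_child d : (d < K)%nat -> d <> r -> desc K r par (par d) d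
| desc_trans k d : (k < K)%nat -> k <> r -> desc K r par k d -> desc K r par (par k) d.

Lemma desc_snoc (K r : nat) (par : nat -> nat) (c p d : nat) :
  desc K r par c p -> par d = p -> (d < K)%nat -> d <> r -> desc K r par c d.
Proof.
  intros H E Hd Hr; induction H as [p Hp Hpr|k p Hk Hkr H IH].
  - apply desc_trans; auto; rewrite <- E; now apply desc_child.
  - apply desc_trans; auto.
Qed.

Lemma desc_root (K r : nat) (par rank : nat -> nat) :
  rooted_tree K r par rank ->
  forall d, (d < K)%nat -> d <> r -> desc K r par r d.
Proof.
  intros (Hr & Hpr & Hpar & Hrank).
  assert (H : forall h d, (rank d < h)%nat -> (d < K)%nat -> d <> r -> desc K r par r d).
  { induction h as [|h IH]; intros d Hh Hd Hdr; [lia|].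
    destruct (Nat.eq_dec (par d) r) as [E|E].
    - pose proof (desc_child K r par d Hd Hdr) as X; now rewrite E in X.
    - apply desc_snoc with (par d); auto.
      apply IH; auto; specialize (Hrank d Hd Hdr); lia. }
  intros d; apply (H (S (rank d))); lia.
Qed.

(* [e p] stands for [x p - x (par p)] and [y] for the Laplacian applied to [x]. *)
Definition edge_system (K r : nat) (par : nat -> nat) (a b e y : nat -> R) : Prop :=
  e r = 0 /\
  forall p, (p < K)%nat ->
    y p = a p * e p - fsum K (fun q => if Nat.eq_dec (par q) p then b q * e q else 0).

Definition dissip (K : nat) (par : nat -> nat) (kap e y : nat -> R) : R :=
  fsum K (fun d => kap d * (e d * (y d - y (par d)))).
Definition wnorm (K : nat) (kap e : nat -> R) : R :=
  fsum K (fun d => kap d * (e d * e d)).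

(* A bidirectional edge ([b > 0]) forces [D = b / a], which cancels the cross term;
   for a unidirectional one a small [D] makes it harmless. *)
Lemma attach_constants (a b c0 c1 K1 : R) :
  0 < a -> 0 <= b -> 0 < c0 -> 0 < c1 -> 0 < K1 ->
  exists D c, 0 < D /\ 0 < c /\
    forall y N0 N1 e, y * y <= N0 -> 0 <= N1 -> (a * e) * (a * e) <= K1 * N1 ->
      c * (N0 + D * N1 + D * a * (e * e)) <=
      c0 * N0 + D * c1 * N1 + (b - D * a) * (e * y).
Proof.
  intros Ha Hb Hc0 Hc1 HK.
  assert (HaK : 0 < K1 / a) by (apply Rdiv_lt_0_compat; lra).
  assert (He : forall e N1, (a * e) * (a * e) <= K1 * N1 ->
             a * (e * e) <= K1 / a * N1).
  { intros e N1 H; apply Rmult_le_reg_l with a; [lra|].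
    replace (a * (K1 / a * N1)) with (K1 * N1) by (field; lra); lra. }
  (* The estimate once no cross term is left: by [He] a share of [N1] pays for [a * (e * e)], whence
     the factor [1 + K1 / a]. *)
  assert (Hcomb : forall D y N0 N1 e g0 g1, 0 < D -> 0 < g0 -> 0 < g1 ->
    y * y <= N0 -> 0 <= N1 -> (a * e) * (a * e) <= K1 * N1 ->
    Rmin g0 (g1 / (1 + K1 / a)) * (N0 + D * N1 + D * a * (e * e)) <=
    g0 * N0 + D * g1 * N1).
  { intros D y N0 N1 e g0 g1 HD H0 H1 Hy HN H.
    specialize (He e N1 H).
    set (c := Rmin g0 (g1 / (1 + K1 / a))).
    assert (Hcg : c <= g0) by apply Rmin_l.
    assert (Hcg1 : c <= g1 / (1 + K1 / a)) by apply Rmin_r.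
    assert (Hc : 0 < c).
    { apply Rmin_glb_lt; [lra|]; apply Rdiv_lt_0_compat; lra. }
    assert (Hc' : c * (1 + K1 / a) <= g1).
    { apply Rmult_le_compat_r with (r := 1 + K1 / a) in Hcg1; [|lra].
      replace (g1 / (1 + K1 / a) * (1 + K1 / a)) with g1 in Hcg1 by (field; nra); lra. }
    assert (HN0 : 0 <= N0) by nra.
    assert (c * N0 <= g0 * N0) by nra.
    assert (D * (a * (e * e)) <= D * (K1 / a * N1)) by (apply Rmult_le_compat_l; lra).
    assert (c * (D * (a * (e * e))) <= c * (D * (K1 / a * N1)))
      by (apply Rmult_le_compat_l; lra).
    assert (0 <= D * N1) by nra.
    assert (c * (1 + K1 / a) * (D * N1) <= g1 * (D * N1))
      by (apply Rmult_le_compat_r; lra).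
    lra. }
  destruct (Req_dec b 0) as [->|Hb0].
  (* Unidirectional edge: this [D] lets Young's inequality bound the cross term [D * (a * e * y)] by
     half of [c0 * N0] plus half of [D * c1 * N1]. *)
  - exists (c0 * c1 / K1), (Rmin (c0 / 2) (c1 / 2 / (1 + K1 / a))).
    assert (HD : 0 < c0 * c1 / K1) by (apply Rdiv_lt_0_compat; nra).
    split; [exact HD|split].
    { apply Rmin_glb_lt; [lra|]; apply Rdiv_lt_0_compat; lra. }
    intros y N0 N1 e Hy HN H; set (D := c0 * c1 / K1) in *.
    eapply Rle_trans; [apply (Hcomb D y N0 N1 e (c0 / 2) (c1 / 2)); lra|].
    (* Young: [a e y <= c1/(2 K1) (a e)^2 + K1/(2 c1) y^2] *)
    assert (Y : a * e * y <= c1 / 2 * N1 + K1 / (2 * c1) * (y * y)).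
    { assert (0 <= (c1 * (a * e) - K1 * y) * (c1 * (a * e) - K1 * y)) by apply Rle_0_sqr.
      assert (c1 * c1 * ((a * e) * (a * e)) <= c1 * c1 * (K1 * N1))
        by (apply Rmult_le_compat_l; nra).
      apply Rmult_le_reg_l with (2 * c1 * K1); [nra|].
      replace (2 * c1 * K1 * (c1 / 2 * N1 + K1 / (2 * c1) * (y * y)))
        with (c1 * c1 * (K1 * N1) + K1 * K1 * (y * y)) by (field; lra).
      nra. }
    assert (D * (K1 / (2 * c1) * (y * y)) = c0 / 2 * (y * y))
      by (unfold D; field; lra).
    assert (D * (a * e * y) <= D * (c1 / 2 * N1 + K1 / (2 * c1) * (y * y)))
      by (apply Rmult_le_compat_l; lra).
    assert (c0 / 2 * (y * y) <= c0 / 2 * N0) by (apply Rmult_le_compat_l; lra).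
    lra.
  - exists (b / a), (Rmin c0 (c1 / (1 + K1 / a))).
    assert (HD : 0 < b / a) by (apply Rdiv_lt_0_compat; lra).
    split; [exact HD|split].
    { apply Rmin_glb_lt; [lra|]; apply Rdiv_lt_0_compat; lra. }
    intros y N0 N1 e Hy HN H.
    replace ((b - b / a * a) * (e * y)) with 0 by (field; lra).
    rewrite Rplus_0_r; apply (Hcomb _ y); lra.
Qed.

(** Induction invariant for a set [D] of vertices below [c] treated so far. The port term
    [g e y * y c] is what the edges not yet counted must balance. When an edge is attached, its
    cross term is absorbed by the share of [y c * y c] on the parent's side and the bound on [g] on
    the child's side. *)
Definition subtree_dissip (K r : nat) (par : nat -> nat) (a b : nat -> R)
  (c : nat) (D : nat -> Prop) (g : (nat -> R) -> (nat -> R) -> R) : Prop :=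
  exists kap c0 K0, 0 < c0 /\ 0 < K0 /\
    (forall d, 0 <= kap d) /\ (forall d, D d -> 0 < kap d) /\
    forall e y, edge_system K r par a b e y ->
      c0 * (y c * y c + wnorm K kap e) <= dissip K par kap e y + g e y * y c /\
      g e y * g e y <= K0 * (y c * y c + wnorm K kap e).

Lemma wnorm_nonneg (K : nat) (kap e : nat -> R) :
  (forall d, 0 <= kap d) -> 0 <= wnorm K kap e.
Proof.
  intros H; apply fsum_nonneg; intros d _; specialize (H d).
  apply Rmult_le_pos; [exact H|apply Rle_0_sqr].
Qed.

(** Scaling the weights of the subtree of [k] by [DD] and giving the edge above [k] the weight
    [DD * a k] turns the port term [a k * e k * y k] of [k] into dissipation. What remains is
    [(b k - DD * a k) * (e k * y c)], which [attach_constants] controls. *)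
Lemma subtree_dissip_attach (K r : nat) (par : nat -> nat) (a b : nat -> R)
  (c k : nat) (D D' : nat -> Prop) (g : (nat -> R) -> (nat -> R) -> R) :
  (k < K)%nat -> par k = c -> 0 < a k -> 0 <= b k ->
  subtree_dissip K r par a b c D g ->
  subtree_dissip K r par a b k D' (fun e _ => a k * e k) ->
  subtree_dissip K r par a b c (fun d => D d \/ d = k \/ D' d)
    (fun e y => g e y + b k * e k).
Proof.
  intros Hk Hp Ha Hb (k0 & c0 & K0 & Hc0 & HK0 & N0 & P0 & H0)
    (k1 & c1 & K1 & Hc1 & HK1 & N1 & P1 & H1).
  destruct (attach_constants (a k) (b k) c0 c1 K1 Ha Hb Hc0 Hc1 HK1)
    as (DD & cc & HD & Hcc & Hatt).
  pose (kap := fun d => k0 d + DD * (k1 d + (if Nat.eq_dec d k then a k else 0))).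
  assert (Hw : forall e, wnorm K kap e =
            wnorm K k0 e + DD * wnorm K k1 e + DD * a k * (e k * e k)).
  { intros e; unfold wnorm, kap.
    transitivity (fsum K (fun d => k0 d * (e d * e d) + DD * (k1 d * (e d * e d))
      + (if Nat.eq_dec d k then DD * a k * (e d * e d) else 0))).
    { apply fsum_ext; intros d _; destruct (Nat.eq_dec d k); ring. }
    rewrite !fsum_plus, fsum_scal; f_equal.
    rewrite (fsum_single _ k); [|exact Hk|].
    - destruct (Nat.eq_dec k k); [reflexivity|lia].
    - intros i _ Hi; destruct (Nat.eq_dec i k); [lia|reflexivity]. }
  assert (Hd : forall e y, dissip K par kap e y =
            dissip K par k0 e y + DD * dissip K par k1 e y
            + DD * a k * (e k * (y k - y c))).
  { intros e y; unfold dissip, kap; rewrite <- Hp.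
    transitivity (fsum K (fun d => k0 d * (e d * (y d - y (par d)))
      + DD * (k1 d * (e d * (y d - y (par d))))
      + (if Nat.eq_dec d k then DD * a k * (e d * (y d - y (par d))) else 0))).
    { apply fsum_ext; intros d _; destruct (Nat.eq_dec d k); ring. }
    rewrite !fsum_plus, fsum_scal; f_equal.
    rewrite (fsum_single _ k); [|exact Hk|].
    - destruct (Nat.eq_dec k k); [reflexivity|lia].
    - intros i _ Hi; destruct (Nat.eq_dec i k); [lia|reflexivity]. }
  assert (HDa : 0 < DD * a k) by (apply Rmult_lt_0_compat; lra).
  (* The last constant comes from [(x + y)^2 <= 2 x^2 + 2 y^2] and from the weight, at least
     [DD * a k], that [e k * e k] carries in [wnorm]. *)
  exists kap, cc, (2 * K0 + 2 * (b k * b k) / (DD * a k)).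
  assert (Hq : 0 <= 2 * (b k * b k) / (DD * a k)).
  { apply Rmult_le_pos; [nra|]; left; now apply Rinv_0_lt_compat. }
  split; [exact Hcc|split; [lra|split; [|split]]].
  - intros d; unfold kap; specialize (N0 d); specialize (N1 d).
    destruct (Nat.eq_dec d k); nra.
  - intros d Hdd; unfold kap; pose proof (N0 d); pose proof (N1 d).
    destruct Hdd as [Hdd|[->|Hdd]].
    + apply P0 in Hdd; destruct (Nat.eq_dec d k); nra.
    + destruct (Nat.eq_dec k k); [nra|lia].
    + apply P1 in Hdd; destruct (Nat.eq_dec d k); nra.
  - intros e y Hs; destruct (H0 e y Hs) as [A0 B0]; destruct (H1 e y Hs) as [A1 B1].
    pose proof (wnorm_nonneg K k0 e N0) as W0; pose proof (wnorm_nonneg K k1 e N1) as W1.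
    rewrite Hw, Hd; split.
    + assert (Hat := Hatt (y c) (y c * y c + wnorm K k0 e) (y k * y k + wnorm K k1 e) (e k)).
      assert (0 <= y k * y k) by apply Rle_0_sqr.
      assert (Hat' := Hat ltac:(lra) ltac:(lra) B1); clear Hat.
      assert (DD * (c1 * (y k * y k + wnorm K k1 e)) <=
        DD * (dissip K par k1 e y + a k * e k * y k))
        by (apply Rmult_le_compat_l; lra).
      assert (0 <= cc * (DD * (y k * y k)))
        by (apply Rmult_le_pos; [lra|apply Rmult_le_pos; lra]).
      lra.
    + assert (Q1 : (g e y + b k * e k) * (g e y + b k * e k)
              <= 2 * (g e y * g e y) + 2 * (b k * b k) * (e k * e k)).
      { assert (0 <= (g e y - b k * e k) * (g e y - b k * e k)) by apply Rle_0_sqr; lra. }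
      assert (Q2 : 2 * (b k * b k) / (DD * a k) * (DD * a k * (e k * e k))
              = 2 * (b k * b k) * (e k * e k)) by (field; lra).
      assert (0 <= y c * y c) by apply Rle_0_sqr.
      assert (0 <= e k * e k) by apply Rle_0_sqr.
      assert (0 <= DD * wnorm K k1 e) by nra.
      assert (0 <= DD * a k * (e k * e k)) by nra.
      set (q := 2 * (b k * b k) / (DD * a k)) in *.
      assert (0 <= q * (y c * y c + wnorm K k0 e + DD * wnorm K k1 e))
        by (apply Rmult_le_pos; lra).
      assert (0 <= K0 * (DD * wnorm K k1 e + DD * a k * (e k * e k)))
        by (apply Rmult_le_pos; lra).
      lra.
Qed.

(** Induction from the leaves, on the distance of [rank c] from its maximum. The children of [c] are
    attached one after the other; when all are in, the edge equation turns [y c] plus the sum of the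
    [b q * e q] into [a c * e c], the port towards the parent. *)
Lemma subtree_dissip_all (K r : nat) (par rank : nat -> nat) (a b : nat -> R) :
  rooted_tree K r par rank ->
  (forall p, (p < K)%nat -> p <> r -> 0 < a p) ->
  (forall p, (p < K)%nat -> p <> r -> 0 <= b p) ->
  forall c, (c < K)%nat ->
    subtree_dissip K r par a b c (desc K r par c) (fun e _ => a c * e c).
Proof.
  intros (Hr & Hpr & Hpar & Hrank) Ha Hb.
  assert (Hmax : exists M, forall p, (p < K)%nat -> (rank p <= M)%nat).
  { clear; induction K as [|K [M HM]]; [exists 0%nat; lia|].
    exists (Nat.max M (rank K)); intros p Hp.
    destruct (Nat.eq_dec p K) as [->|]; [lia|]; specialize (HM p ltac:(lia)); lia. }
  destruct Hmax as [M HM].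
  assert (H : forall h c, (c < K)%nat -> (M - rank c < h)%nat ->
    subtree_dissip K r par a b c (desc K r par c) (fun e _ => a c * e c)).
  { induction h as [|h IH]; intros c Hc Hh; [lia|].
    assert (Hin : forall k, (k <= K)%nat -> subtree_dissip K r par a b c
      (fun d => exists q, (q < k)%nat /\ q <> r /\ par q = c /\ (d = q \/ desc K r par q d))
      (fun e y => y c + fsum k (fun q => if Nat.eq_dec (par q) c then b q * e q else 0))).
    { induction k as [|k IHk]; intros Hk.
      (* No child yet: the weights are zero and the port signal is [y c] itself, so both constants
         can be 1. *)
      - exists (fun _ => 0), 1, 1; do 2 (split; [lra|]); split; [intros; lra|split].
        + intros d (q & Hq & _); lia.
        + intros e y _; unfold wnorm, dissip.
          rewrite !fsum_zero by (intros; ring); simpl; lra.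
      - specialize (IHk ltac:(lia)).
        destruct (classic (par k = c /\ k <> r)) as [[Hp Hkr]|Hno].
        + assert (Hk' : subtree_dissip K r par a b k (desc K r par k)
                          (fun e _ => a k * e k)).
          { apply IH; [lia|].
            specialize (Hrank k ltac:(lia) Hkr); rewrite Hp in Hrank.
            pose proof (HM k ltac:(lia)); lia. }
          destruct (subtree_dissip_attach K r par a b c k _ _ _ ltac:(lia) Hp
            (Ha k ltac:(lia) Hkr) (Hb k ltac:(lia) Hkr) IHk Hk')
            as (kap & c0 & K0 & H1 & H2 & H3 & H4 & H5).
          exists kap, c0, K0; do 3 (split; [assumption|]); split.
          * intros d (q & Hq & Hqr & Hqp & Hd); apply H4.
            destruct (Nat.eq_dec q k) as [->|]; [tauto|].
            left; exists q; repeat split; auto; lia.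
          * intros e y Hs; simpl; destruct (Nat.eq_dec (par k) c); [|tauto].
            rewrite <- Rplus_assoc; now apply H5.
        + destruct IHk as (kap & c0 & K0 & H1 & H2 & H3 & H4 & H5).
          exists kap, c0, K0; do 3 (split; [assumption|]); split.
          * intros d (q & Hq & Hqr & Hqp & Hd); apply H4.
            destruct (Nat.eq_dec q k) as [->|]; [tauto|].
            exists q; repeat split; auto; lia.
          * intros e y Hs; simpl.
            replace (if Nat.eq_dec (par k) c then b k * e k else 0) with 0.
            { rewrite Rplus_0_r; now apply H5. }
            (* The root is its own parent and so occurs in the sum over its children, but
               [e r = 0]. *)
            destruct (Nat.eq_dec (par k) c) as [E|]; [|reflexivity].
            destruct (Nat.eq_dec k r) as [->|]; [|tauto].
            destruct Hs as [-> _]; ring. }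
    destruct (Hin K ltac:(lia)) as (kap & c0 & K0 & H1 & H2 & H3 & H4 & H5).
    exists kap, c0, K0; do 3 (split; [assumption|]); split.
    - intros d Hd; apply H4; destruct Hd as [d Hd Hdr|k d Hk Hkr Hd].
      + exists d; auto.
      + exists k; auto.
    - intros e y Hs; destruct (H5 e y Hs) as [A1 A2].
      destruct Hs as [_ Hs]; specialize (Hs c Hc).
      set (F := fsum K _) in *.
      replace (y c + F) with (a c * e c) in A1, A2 by lra; auto. }
  intros c Hc; apply (H (S (M - rank c))); lia.
Qed.

(** At the root the port signal is [a r * e r = 0], so the invariant loses its port term. *)
Lemma tree_dissipation (K r : nat) (par rank : nat -> nat) (a b : nat -> R) :
  rooted_tree K r par rank ->
  (forall p, (p < K)%nat -> p <> r -> 0 < a p) ->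
  (forall p, (p < K)%nat -> p <> r -> 0 <= b p) ->
  exists kap c0, 0 < c0 /\ (forall d, 0 <= kap d) /\
    (forall d, (d < K)%nat -> d <> r -> 0 < kap d) /\
    forall e y, edge_system K r par a b e y ->
      c0 * wnorm K kap e <= dissip K par kap e y.
Proof.
  intros HT Ha Hb.
  destruct (subtree_dissip_all K r par rank a b HT Ha Hb r)
    as (kap & c0 & K0 & H1 & H2 & H3 & H4 & H5); [apply HT|].
  exists kap, c0; split; [exact H1|split; [exact H3|split]].
  - intros d Hd Hdr; apply H4; now apply (desc_root K r par rank).
  - intros e y Hs; destruct (H5 e y Hs) as [A _]; destruct Hs as [E _].
    rewrite E in A; assert (0 <= y r * y r) by apply Rle_0_sqr; nra.
Qed.

(** * Vanishing signals *)

Definition vanishes (f : R -> R) : Prop :=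
  forall eps, eps > 0 -> exists T, forall t, t >= T -> Rabs (f t) < eps.

Lemma vanishes_ext (f g : R -> R) :
  (forall t, f t = g t) -> vanishes f -> vanishes g.
Proof.
  intros E H eps He; destruct (H eps He) as [T HT].
  exists T; intros t Ht; rewrite <- E; auto.
Qed.

Lemma vanishes_0 : vanishes (fun _ => 0).
Proof. intros eps He; exists 0; intros t _; rewrite Rabs_R0; lra. Qed.

Lemma vanishes_plus (f g : R -> R) :
  vanishes f -> vanishes g -> vanishes (fun t => f t + g t).
Proof.
  intros Hf Hg eps He.
  destruct (Hf (eps / 2) ltac:(lra)) as [T1 H1].
  destruct (Hg (eps / 2) ltac:(lra)) as [T2 H2].
  exists (Rmax T1 T2); intros t Ht.
  pose proof (Rmax_l T1 T2); pose proof (Rmax_r T1 T2).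
  specialize (H1 t ltac:(lra)); specialize (H2 t ltac:(lra)).
  pose proof (Rabs_triang (f t) (g t)); lra.
Qed.

Lemma vanishes_scal (a : R) (f : R -> R) :
  vanishes f -> vanishes (fun t => a * f t).
Proof.
  intros Hf eps He; pose proof (Rabs_pos a).
  destruct (Hf (eps / (Rabs a + 1))) as [T HT]; [apply Rdiv_lt_0_compat; lra|].
  exists T; intros t Ht; specialize (HT t Ht); rewrite Rabs_mult.
  pose proof (Rabs_pos (f t)).
  apply Rle_lt_trans with ((Rabs a + 1) * Rabs (f t)); [nra|].
  apply Rlt_le_trans with ((Rabs a + 1) * (eps / (Rabs a + 1))).
  - apply Rmult_lt_compat_l; lra.
  - right; field; lra.
Qed.

Lemma vanishes_fsum (k : nat) (f : nat -> R -> R) :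
  (forall i, (i < k)%nat -> vanishes (f i)) -> vanishes (fun t => fsum k (fun i => f i t)).
Proof.
  induction k as [|k IH]; intros H; simpl; [exact vanishes_0|].
  apply vanishes_plus; [apply IH; intros|]; apply H; lia.
Qed.

Lemma vanishes_sqr (f : R -> R) (c : R) (g : R -> R) :
  0 < c -> (forall t, c * (f t * f t) <= g t) -> vanishes g -> vanishes f.
Proof.
  intros Hc H Hg eps He.
  destruct (Hg (c * (eps * eps))) as [T HT]; [apply Rmult_lt_0_compat; nra|].
  exists T; intros t Ht; specialize (HT t Ht); specialize (H t).
  pose proof (Rle_abs (g t)).
  assert (f t * f t < eps * eps) by (apply Rmult_lt_reg_l with c; lra).
  apply Rabs_def1; nra.
Qed.

Definition bounded_forward (f : R -> R) : Prop :=
  exists M, forall t, 0 <= t -> Rabs (f t) <= M.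

(* Landau--Hadamard: over a step [d], [f'] moves by at most [M d] while its mean is
   [(f (t + d) - f t) / d], which tends to 0. *)
Lemma deriv_vanishes (f f' f'' : R -> R) (l : R) :
  (forall t, derivable_pt_lim f t (f' t)) ->
  (forall t, derivable_pt_lim f' t (f'' t)) ->
  bounded_forward f'' -> vanishes (fun t => f t - l) -> vanishes f'.
Proof.
  intros D1 D2 [M HM] Hv eps He.
  assert (HM0 : 0 <= M) by (specialize (HM 0 ltac:(lra)); pose proof (Rabs_pos (f'' 0)); lra).
  (* This step keeps the variation [M * d] of [f'] below [eps / 2]; the tolerance [eps / 4 * d] on
     [f], used at both ends, leaves [eps / 2] for the mean. *)
  pose (d := eps / (2 * (M + 1))).
  assert (Hd : 0 < d) by (apply Rdiv_lt_0_compat; lra).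
  assert (HMd : M * d < eps / 2).
  { replace (eps / 2) with ((M + 1) * d) by (unfold d; field; lra); nra. }
  destruct (Hv (eps / 4 * d)) as [T HT]; [nra|].
  exists (Rmax 0 T); intros t Ht.
  pose proof (Rmax_l 0 T); pose proof (Rmax_r 0 T).
  pose proof (HT t ltac:(lra)) as E1; pose proof (HT (t + d) ltac:(lra)) as E2.
  destruct (MVT_cor2 f f' t (t + d) ltac:(lra) ltac:(intros; apply D1)) as (s & Es & Hs).
  destruct (MVT_cor2 f' f'' t s ltac:(lra) ltac:(intros; apply D2)) as (s' & Es' & Hs').
  pose proof (HM s' ltac:(lra)) as Hb.
  assert (Hdiff : Rabs (f' s - f' t) <= M * d).
  { rewrite Es', Rabs_mult, (Rabs_pos_eq (s - t)) by lra.
    apply Rmult_le_compat; try lra; apply Rabs_pos. }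
  assert (Hmean : Rabs (f' s) * d < eps / 2 * d).
  { rewrite <- (Rabs_pos_eq d) at 1 by lra; rewrite <- Rabs_mult.
    replace (f' s * d) with ((f (t + d) - l) - (f t - l)) by lra.
    unfold Rminus at 1; pose proof (Rabs_triang (f (t + d) - l) (- (f t - l))) as Ht'.
    rewrite Rabs_Ropp in Ht'; lra. }
  apply Rmult_lt_reg_r in Hmean; [|lra].
  replace (f' t) with (f' s + - (f' s - f' t)) by ring.
  pose proof (Rabs_triang (f' s) (- (f' s - f' t))) as Htr.
  rewrite Rabs_Ropp in Htr; lra.
Qed.

Lemma nonincreasing_of_deriv (f f' : R -> R) :
  (forall t, derivable_pt_lim f t (f' t)) -> (forall t, f' t <= 0) ->
  forall s t, s <= t -> f t <= f s.
Proof.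
  intros D H s t [Hst| ->]; [|lra].
  destruct (MVT_cor2 f f' s t Hst ltac:(intros; apply D)) as (c & E & _).
  specialize (H c); nra.
Qed.

Lemma nonincreasing_limit (f : R -> R) :
  (forall s t, s <= t -> f t <= f s) -> (forall t, 0 <= f t) ->
  exists l, vanishes (fun t => f t - l).
Proof.
  intros Hdec Hpos.
  destruct (completeness (fun x => exists t, x = - f t)) as [l [Hub Hlub]].
  - exists 0; intros x [t ->]; specialize (Hpos t); lra.
  - exists (- f 0); now exists 0.
  - exists (- l); intros eps He.
    destruct (classic (exists T, - f T > l - eps)) as [[T HT]|Hno].
    + exists T; intros t Ht; specialize (Hdec T t ltac:(lra)).
      assert (- f t <= l) by (apply Hub; now exists t).
      rewrite Rabs_pos_eq; lra.
    + exfalso; assert (l <= l - eps); [|lra].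
      apply Hlub; intros x [t ->]; apply Rnot_lt_le; intros Hx; apply Hno; now exists t.
Qed.

(** Polynomials in the coordinates. Once the coordinates are bounded and have derivatives in the
    class, the same holds for every member, so second derivatives are bounded without computing
    them. *)
Inductive signal (K n : nat) (z : nat -> nat -> R -> R) : (R -> R) -> Prop :=
| signal_gen c k : (c < K)%nat -> (k < n)%nat -> signal K n z (z c k)
| signal_cst a : signal K n z (fun _ => a)
| signal_plus f g : signal K n z f -> signal K n z g -> signal K n z (fun t => f t + g t)
| signal_mult f g : signal K n z f -> signal K n z g -> signal K n z (fun t => f t * g t).

Lemma signal_fsum (K n : nat) (z : nat -> nat -> R -> R) (k : nat) (f : nat -> R -> R) :
  (forall i, (i < k)%nat -> signal K n z (f i)) ->
  signal K n z (fun t => fsum k (fun i => f i t)).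
Proof.
  induction k as [|k IH]; intros H; simpl; [apply signal_cst|].
  apply signal_plus; [apply IH; intros|]; apply H; lia.
Qed.

Lemma signal_bounded (K n : nat) (z : nat -> nat -> R -> R) (f : R -> R) :
  (forall c k, (c < K)%nat -> (k < n)%nat -> bounded_forward (z c k)) ->
  signal K n z f -> bounded_forward f.
Proof.
  intros Hz H; induction H as [c k Hc Hk|a|f g Hf [M1 H1] Hg [M2 H2]|f g Hf [M1 H1] Hg [M2 H2]].
  - now apply Hz.
  - exists (Rabs a); intros; lra.
  - exists (M1 + M2); intros t Ht; specialize (H1 t Ht); specialize (H2 t Ht).
    pose proof (Rabs_triang (f t) (g t)); lra.
  - exists (M1 * M2); intros t Ht; specialize (H1 t Ht); specialize (H2 t Ht).
    rewrite Rabs_mult; apply Rmult_le_compat; auto; apply Rabs_pos.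
Qed.

Lemma derivable_pt_lim_fsum (k : nat) (f : nat -> R -> R) (f' : nat -> R) (t : R) :
  (forall i, (i < k)%nat -> derivable_pt_lim (f i) t (f' i)) ->
  derivable_pt_lim (fun s => fsum k (fun i => f i s)) t (fsum k f').
Proof.
  induction k as [|k IH]; intros H; simpl; [apply derivable_pt_lim_const|].
  apply (derivable_pt_lim_plus (fun s => fsum k (fun i => f i s)) (f k));
    [apply IH; intros|]; apply H; lia.
Qed.

Lemma signal_deriv (K n : nat) (z : nat -> nat -> R -> R) (f : R -> R) :
  (forall c k, (c < K)%nat -> (k < n)%nat ->
     exists g, signal K n z g /\ forall t, derivable_pt_lim (z c k) t (g t)) ->
  signal K n z f -> exists g, signal K n z g /\ forall t, derivable_pt_lim f t (g t).
Proof.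
  intros Hz H; induction H as [c k Hc Hk|a|f g Hf [f' [Sf Df]] Hg [g' [Sg Dg]]
                              |f g Hf [f' [Sf Df]] Hg [g' [Sg Dg]]].
  - now apply Hz.
  - exists (fun _ => 0); split; [apply signal_cst|intros; apply derivable_pt_lim_const].
  - exists (fun t => f' t + g' t); split; [now apply signal_plus|].
    intros t; now apply (derivable_pt_lim_plus f g).
  - exists (fun t => f' t * g t + f t * g' t); split.
    + now apply signal_plus; apply signal_mult.
    + intros t; now apply (derivable_pt_lim_mult f g).
Qed.

(** Uniqueness of derivatives identifies [f'] with a signal, whose own derivative is again a bounded
    signal, as [deriv_vanishes] requires. *)
Lemma signal_deriv_vanishes (K n : nat) (z : nat -> nat -> R -> R) (f f' : R -> R) (l : R) :
  (forall c k, (c < K)%nat -> (k < n)%nat -> bounded_forward (z c k)) ->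
  (forall c k, (c < K)%nat -> (k < n)%nat ->
     exists g, signal K n z g /\ forall t, derivable_pt_lim (z c k) t (g t)) ->
  signal K n z f -> (forall t, derivable_pt_lim f t (f' t)) ->
  vanishes (fun t => f t - l) -> vanishes f'.
Proof.
  intros Hb Hz Hf Hf' Hl.
  destruct (signal_deriv K n z f Hz Hf) as (g & Sg & Dg).
  destruct (signal_deriv K n z g Hz Sg) as (h & Sh & Dh).
  apply vanishes_ext with g.
  - intros t; eapply uniqueness_limite; [apply Dg|apply Hf'].
  - eapply deriv_vanishes; eauto; eapply signal_bounded; eauto.
Qed.

(** * Synchronization on a rooted tree *)

Lemma qform_mv (n : nat) (M : mat) (x : nat -> R) :
  qform n M x = fsum n (fun i => x i * mv n M x i).
Proof.
  apply fsum_ext; intros i _; unfold mv; rewrite <- fsum_scal.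
  apply fsum_ext; intros; ring.
Qed.

Lemma dot_mv_symmetric (n : nat) (M : mat) (x y : nat -> R) :
  symmetric n M ->
  fsum n (fun i => x i * mv n M y i) = fsum n (fun i => y i * mv n M x i).
Proof.
  intros H; rewrite dot_mv_tr; apply fsum_ext; intros j Hj.
  rewrite Rmult_comm; f_equal; apply fsum_ext; intros i Hi.
  unfold mtr; now rewrite H.
Qed.

Lemma qform_skew (n : nat) (M : mat) (x : nat -> R) : skew n M -> qform n M x = 0.
Proof.
  intros H; assert (E : qform n M x = - qform n M x); [|lra].
  unfold qform at 1; rewrite fsum_swap; unfold qform.
  replace (- fsum n (fun i => fsum n (fun j => x i * M i j * x j)))
    with (-1 * fsum n (fun i => fsum n (fun j => x i * M i j * x j))) by ring.
  rewrite <- fsum_scal; apply fsum_ext; intros i Hi.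
  rewrite <- fsum_scal; apply fsum_ext; intros j Hj.
  rewrite (H j i) by assumption; ring.
Qed.

Lemma qform_msub (n : nat) (M N : mat) (x : nat -> R) :
  qform n (msub M N) x = qform n M x - qform n N x.
Proof.
  unfold qform; rewrite <- fsum_minus; apply fsum_ext; intros i _.
  rewrite <- fsum_minus; apply fsum_ext; intros j _; unfold msub; ring.
Qed.

Lemma pos_def_qform_nonneg (n : nat) (Q : mat) (x : nat -> R) :
  pos_def n Q -> 0 <= qform n Q x.
Proof.
  intros [_ H].
  destruct (classic (exists i, (i < n)%nat /\ x i <> 0)) as [E|E].
  - specialize (H x E); lra.
  - right; symmetry; apply fsum_zero; intros i Hi; apply fsum_zero; intros j Hj.
    destruct (Req_dec (x i) 0) as [->|]; [ring|]; exfalso; apply E; eauto.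
Qed.

(** With [p = Q z], the skew part contributes [p^T J p = 0], the resistive part [- p^T R p <= 0],
    and [p^T B u] pairs the output [B^T Q z] with [u]. *)
Lemma port_hamiltonian_passive (n m : nat) (Q J Rm B : mat) (z u : nat -> R) :
  skew n J -> pos_semidef n Rm ->
  fsum n (fun k => (mv n (mmul n (msub J Rm) Q) z k - mv m B u k) * mv n Q z k)
  <= - fsum m (fun b => mv n (mmul n (mtr B) Q) z b * u b).
Proof.
  intros HJ [_ HR]; set (p := mv n Q z).
  transitivity (qform n (msub J Rm) p - fsum n (fun k => p k * mv m B u k)).
  - right; rewrite qform_mv, <- fsum_minus; apply fsum_ext; intros k _.
    rewrite mv_mmul; fold p; ring.
  - rewrite qform_msub, qform_skew by assumption; specialize (HR p).
    rewrite dot_mv_tr.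
    rewrite (fsum_ext m (fun b => mv n (mmul n (mtr B) Q) z b * u b)
               (fun b => mv n (mtr B) p b * u b)); [lra|].
    intros b _; now rewrite mv_mmul.
Qed.

Lemma derivable_pt_lim_qform (n : nat) (Q : mat) (z : nat -> R -> R) (d : nat -> R) (t : R) :
  symmetric n Q ->
  (forall k, (k < n)%nat -> derivable_pt_lim (z k) t (d k)) ->
  derivable_pt_lim (fun s => fsum n (fun k => z k s * fsum n (fun l => Q k l * z l s))) t
    (2 * fsum n (fun k => d k * mv n Q (fun l => z l t) k)).
Proof.
  intros HQ Hd.
  replace (2 * fsum n (fun k => d k * mv n Q (fun l => z l t) k))
    with (fsum n (fun k => d k * mv n Q (fun l => z l t) k
                           + z k t * mv n Q d k)).
  - apply derivable_pt_lim_fsum; intros k Hk.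
    apply (derivable_pt_lim_mult (z k) (fun s => fsum n (fun l => Q k l * z l s))).
    + now apply Hd.
    + apply derivable_pt_lim_fsum; intros l Hl.
      now apply (derivable_pt_lim_scal (z l)), Hd.
  - rewrite fsum_plus, (dot_mv_symmetric n Q (fun k => z k t) d HQ); ring.
Qed.

Lemma dot_idm (n j : nat) (z : nat -> R) :
  (j < n)%nat -> fsum n (fun k => idm j k * z k) = z j.
Proof.
  intros Hj; rewrite (fsum_single _ j); [|exact Hj|]; unfold idm.
  - destruct (Nat.eq_dec j j); [ring|lia].
  - intros i _ Hi; destruct (Nat.eq_dec j i); [lia|ring].
Qed.

(* The functionals bounded along [z] form a subspace containing the range of [Q],
   because [2 |u^T Q z| <= u^T Q u + z^T Q z]. *)
Lemma qform_bounded_coord (n : nat) (Q : mat) (z : nat -> R -> R) (M : R) :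
  pos_def n Q ->
  (forall t, 0 <= t -> qform n Q (fun k => z k t) <= M) ->
  forall k, (k < n)%nat -> bounded_forward (z k).
Proof.
  intros HQ HM.
  assert (H : forall v, bounded_forward (fun t => fsum n (fun k => v k * z k t))).
  { apply (annihilator_trivial_full n).
    - split; [|split].
      + intros v v' E [N HN]; exists N; intros t Ht; specialize (HN t Ht).
        rewrite <- (fsum_ext n (fun k => v k * z k t)); [exact HN|].
        intros i Hi; now rewrite E.
      + intros v v' a [N HN] [N' HN']; exists (N + Rabs a * N'); intros t Ht.
        specialize (HN t Ht); specialize (HN' t Ht).
        rewrite (fsum_ext n _ (fun k => v k * z k t + a * (v' k * z k t)))
          by (intros; ring).
        rewrite fsum_plus, fsum_scal.
        eapply Rle_trans; [apply Rabs_triang|]; rewrite Rabs_mult.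
        apply Rplus_le_compat; [exact HN|].
        apply Rmult_le_compat_l; [apply Rabs_pos|exact HN'].
      + exists 0; intros t _; rewrite fsum_zero by (intros; ring).
        rewrite Rabs_R0; lra.
    - intros x Hx i Hi.
      destruct (Req_dec (x i) 0) as [|Hne]; [assumption|exfalso].
      assert (Hp : qform n Q x > 0) by (apply HQ; eauto).
      assert (Hb : bounded_forward (fun t => fsum n (fun k => mv n Q x k * z k t))).
      { exists ((qform n Q x + M) / 2); intros t Ht; specialize (HM t Ht).
        (* Nonnegativity of the form at [z + x] and at [z - x] bounds the pairing with [Q x] from
           both sides. *)
        pose (w := fun s k => z k t + s * x k).
        assert (E : forall s, qform n Q (w s) = qform n Q (fun k => z k t)
           + 2 * s * fsum n (fun k => mv n Q x k * z k t) + s * s * qform n Q x).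
        { intros s; rewrite !qform_mv.
          assert (Ew : forall k, mv n Q (w s) k = mv n Q (fun k => z k t) k + s * mv n Q x k).
          { intros k; unfold mv, w; rewrite <- fsum_scal, <- fsum_plus.
            apply fsum_ext; intros; ring. }
          assert (Es := dot_mv_symmetric n Q x (fun k => z k t) (proj1 HQ)).
          rewrite (fsum_ext n (fun k => mv n Q x k * z k t) (fun k => z k t * mv n Q x k))
            by (intros; ring).
          rewrite (fsum_ext n _ (fun k => z k t * mv n Q (fun k => z k t) k
            + s * (z k t * mv n Q x k) + s * (x k * mv n Q (fun k => z k t) k)
            + s * s * (x k * mv n Q x k))).
          2:{ intros k _; rewrite Ew; unfold w; ring. }
          rewrite !fsum_plus, !fsum_scal, Es; ring. }
        pose proof (pos_def_qform_nonneg n Q (w 1) HQ) as P1.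
        pose proof (pos_def_qform_nonneg n Q (w (-1)) HQ) as P2.
        rewrite E in P1, P2; apply Rabs_le; lra. }
      (* An [x] orthogonal to every bounded functional is orthogonal to [Q x], against
         [x^T Q x > 0]. *)
      specialize (Hx _ Hb).
      rewrite qform_mv, (fsum_ext n _ (fun i => mv n Q x i * x i)), Hx in Hp
        by (intros; ring); lra. }
  intros k Hk; destruct (H (idm k)) as [N HN]; exists N; intros t Ht.
  specialize (HN t Ht); now rewrite dot_idm in HN.
Qed.

(** Invariance under [A^T] puts all rows of [C A^k] into [S], so a vector annihilated by [S] is
    unobservable and hence 0. *)
Lemma observable_full (n p : nat) (A C : mat) (S : (nat -> R) -> Prop) :
  observable n p A C -> subspace n S ->
  (forall c, (c < p)%nat -> S (C c)) ->
  (forall v, S v -> S (mv n (mtr A) v)) -> forall v, S v.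
Proof.
  intros Hobs HS HC HA; apply (annihilator_trivial_full n S HS).
  assert (Hpow : forall k v, S v -> S (mv n (mtr (mpow n A k)) v)).
  { induction k as [|k IH]; intros v Sv; simpl.
    - eapply (proj1 HS); [|exact Sv]; intros i Hi; symmetry.
      rewrite <- (dot_idm n i v Hi); apply fsum_ext; intros l _; unfold mtr, idm.
      destruct (Nat.eq_dec l i), (Nat.eq_dec i l); lia || reflexivity.
    - eapply (proj1 HS); [|exact (IH _ (HA v Sv))]; intros i Hi.
      rewrite <- mv_mmul; apply fsum_ext; intros l _; f_equal.
      unfold mtr, mmul; apply fsum_ext; intros; ring. }
  intros x Hx; apply Hobs; intros k c _ Hc.
  rewrite <- (Hx _ (Hpow k _ (HC c Hc))).
  apply fsum_ext; intros i _; f_equal; unfold mmul, mv, mtr.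
  apply fsum_ext; intros; ring.
Qed.

Lemma tree_synchronization (n m K r : nat) (Q J Rm B lap : mat) (par rank : nat -> nat)
  (a b : nat -> R) (xi : R -> nat -> nat -> R) :
  pos_def n Q -> skew n J -> pos_semidef n Rm ->
  observable n m (mmul n (msub J Rm) Q) (mmul n (mtr B) Q) ->
  rooted_tree K r par rank ->
  (forall p, (p < K)%nat -> p <> r -> 0 < a p) ->
  (forall p, (p < K)%nat -> p <> r -> 0 <= b p) ->
  (forall x, edge_system K r par a b (fun p => x p - x (par p)) (mv K lap x)) ->
  (forall t p k, (p < K)%nat -> (k < n)%nat ->
     derivable_pt_lim (fun s => xi s p k) t
       (mv n (mmul n (msub J Rm) Q) (xi t p) k
        - mv m B (fun c => mv K lap (fun q => mv n (mmul n (mtr B) Q) (xi t q) c) p) k)) ->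
  forall p q k, (p < K)%nat -> (q < K)%nat -> (k < n)%nat ->
    vanishes (fun t => xi t p k - xi t q k).
Proof.
  intros HQ HJ HR Hobs HT Ha Hb Hlap Hsol.
  set (A := mmul n (msub J Rm) Q) in *; set (C := mmul n (mtr B) Q) in *.
  destruct (tree_dissipation K r par rank a b HT Ha Hb)
    as (kap & c0 & Hc0 & Hkap & Hkap' & Hdis).
  destruct HT as (Hr & Hpr & Hpar & Hrank).
  (* State differences [z] across the edge above [c], coupling signals [Y] at vertex [p] in channel
     [o], and output differences [e]. *)
  pose (z := fun c k t => xi t c k - xi t (par c) k).
  pose (Y := fun p o t => mv K lap (fun q => mv n C (xi t q) o) p).
  pose (e := fun c o t => mv n C (fun l => z c l t) o).
  assert (Hez : forall c o t, e c o t = mv n C (xi t c) o - mv n C (xi t (par c)) o)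
    by (intros; unfold e, z; apply mv_minus).
  assert (Hsys : forall o t, edge_system K r par a b (fun c => e c o t) (fun p => Y p o t)).
  { intros o t; destruct (Hlap (fun q => mv n C (xi t q) o)) as [E1 E2]; split.
    - now rewrite Hez.
    - intros p Hp; unfold Y; rewrite E2 by exact Hp; f_equal; [now rewrite Hez|].
      apply fsum_ext; intros q _; now rewrite Hez. }
  assert (Hz' : forall c k t, (c < K)%nat -> (k < n)%nat ->
    derivable_pt_lim (z c k) t
      (mv n A (fun l => z c l t) k - mv m B (fun o => Y c o t - Y (par c) o t) k)).
  { intros c k t Hc Hk.
    replace (mv n A _ k - _) with
      ((mv n A (xi t c) k - mv m B (fun o => Y c o t) k)
       - (mv n A (xi t (par c)) k - mv m B (fun o => Y (par c) o t) k)).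
    - apply (derivable_pt_lim_minus (fun s => xi s c k) (fun s => xi s (par c) k));
        apply Hsol; auto.
    - unfold z; rewrite !mv_minus; ring. }
  pose (V := fun t => fsum K (fun c => kap c *
               fsum n (fun k => z c k t * fsum n (fun l => Q k l * z c l t)))).
  pose (V' := fun t => fsum K (fun c => kap c * (2 * fsum n (fun k =>
      (mv n A (fun l => z c l t) k - mv m B (fun o => Y c o t - Y (par c) o t) k)
      * mv n Q (fun l => z c l t) k)))).
  assert (HV : forall t, derivable_pt_lim V t (V' t)).
  { intros t; apply derivable_pt_lim_fsum; intros c Hc.
    apply (derivable_pt_lim_scal
      (fun t => fsum n (fun k => z c k t * fsum n (fun l => Q k l * z c l t)))).
    apply derivable_pt_lim_qform; [apply HQ|]; intros k Hk; now apply Hz'. }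
  assert (HVq : forall t, V t = fsum K (fun c => kap c * qform n Q (fun k => z c k t))).
  { intros t; apply fsum_ext; intros c _; now rewrite qform_mv. }
  (* Passivity on each edge gives [X1] after exchanging the sums over edges and channels;
     [tree_dissipation], applied channel by channel, gives [X2]. *)
  assert (HV'e : forall t, 2 * c0 * fsum m (fun o => wnorm K kap (fun c => e c o t)) <= - V' t).
  { intros t.
    assert (X1 : V' t <= -2 * fsum m (fun o => dissip K par kap (fun c => e c o t) (fun p => Y p o t))).
    { unfold dissip; rewrite fsum_swap, <- fsum_scal; apply fsum_le; intros c Hc.
      pose proof (port_hamiltonian_passive n m Q J Rm B (fun l => z c l t)
        (fun o => Y c o t - Y (par c) o t) HJ HR) as P.
      fold A C in P; fold (e c) in P; specialize (Hkap c).
      rewrite fsum_scal.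
      apply Rmult_le_compat_l with (r := 2 * kap c) in P; [|lra].
      unfold e; lra. }
    assert (X2 : c0 * fsum m (fun o => wnorm K kap (fun c => e c o t)) <=
       fsum m (fun o => dissip K par kap (fun c => e c o t) (fun p => Y p o t))).
    { rewrite <- fsum_scal; apply fsum_le; intros o _; apply Hdis, Hsys. }
    lra. }
  assert (HW : forall t o, (o < m)%nat ->
     wnorm K kap (fun c => e c o t) <= fsum m (fun o => wnorm K kap (fun c => e c o t))).
  { intros t o Ho.
    apply (fsum_term_le m o (fun o => wnorm K kap (fun c => e c o t))); [|exact Ho].
    intros; now apply wnorm_nonneg. }
  assert (HV'0 : forall t, V' t <= 0).
  { intros t; specialize (HV'e t).
    assert (0 <= fsum m (fun o => wnorm K kap (fun c => e c o t)))
      by (apply fsum_nonneg; intros; now apply wnorm_nonneg).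
    nra. }
  assert (HVpos : forall c t, (c < K)%nat -> 0 <= kap c * qform n Q (fun k => z c k t)).
  { intros; apply Rmult_le_pos; [apply Hkap|now apply pos_def_qform_nonneg]. }
  assert (Hdec := nonincreasing_of_deriv V V' HV HV'0).
  assert (Hzr : forall k t, z r k t = 0) by (intros; unfold z; rewrite Hpr; ring).
  assert (Hbd : forall c k, (c < K)%nat -> (k < n)%nat -> bounded_forward (z c k)).
  (* The weight of the root may be zero, but so is its difference. Elsewhere the form of [z c] is at
     most [V t / kap c], and [V t <= V 0] for [t >= 0]. *)
  { intros c k Hc Hk; destruct (Nat.eq_dec c r) as [->|Hcr].
    - exists 0; intros; rewrite Hzr, Rabs_R0; lra.
    - specialize (Hkap' c Hc Hcr).
      apply (qform_bounded_coord n Q (z c) (V 0 / kap c)); auto.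
      intros t Ht; apply Rmult_le_reg_l with (kap c); [exact Hkap'|].
      replace (kap c * (V 0 / kap c)) with (V 0) by (field; lra).
      eapply Rle_trans; [|apply (Hdec 0 t Ht)]; rewrite HVq.
      apply (fsum_term_le K c (fun c => kap c * qform n Q (fun k => z c k t))); auto. }
  assert (Hes : forall c o, (c < K)%nat -> signal K n z (e c o)).
  { intros c o Hc; apply signal_fsum; intros l Hl.
    apply signal_mult; [apply signal_cst|now apply signal_gen]. }
  assert (Hsig : forall c k, (c < K)%nat -> (k < n)%nat ->
     exists g, signal K n z g /\ forall t, derivable_pt_lim (z c k) t (g t)).
  { intros c k Hc Hk.
    (* The edge equation rewrites the coupling in terms of the [e], which are signals, whereas the
       states [xi] are not among the generators. *)
    pose (Yg := fun p o t => a p * e p o t + -1 *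
      fsum K (fun q => (if Nat.eq_dec (par q) p then b q else 0) * e q o t)).
    assert (EY : forall p o t, (p < K)%nat -> Y p o t = Yg p o t).
    { intros p o t Hp; destruct (Hsys o t) as [_ E]; rewrite E by exact Hp; unfold Yg.
      rewrite (fsum_ext K _ (fun q => (if Nat.eq_dec (par q) p then b q else 0) * e q o t));
        [ring|]; intros q _; destruct (Nat.eq_dec (par q) p); ring. }
    assert (SY : forall p o, (p < K)%nat -> signal K n z (Yg p o)).
    { intros p o Hp; apply signal_plus; apply signal_mult; auto; try apply signal_cst.
      apply signal_fsum; intros q Hq; apply signal_mult; auto; apply signal_cst. }
    exists (fun t => fsum n (fun l => A k l * z c l t)
                     + -1 * fsum m (fun o => B k o * (Yg c o t + -1 * Yg (par c) o t))).
    split.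
    - apply signal_plus; [|apply signal_mult; [apply signal_cst|]];
        apply signal_fsum; intros i Hi; (apply signal_mult; [apply signal_cst|]).
      + now apply signal_gen.
      + apply signal_plus; [|apply signal_mult; [apply signal_cst|]]; auto.
    - intros t.
      replace (_ + _) with
        (mv n A (fun l => z c l t) k - mv m B (fun o => Y c o t - Y (par c) o t) k);
        [now apply Hz'|].
      unfold mv at 1; unfold Rminus at 1; f_equal.
      replace (mv m B (fun o => Y c o t - Y (par c) o t) k)
        with (fsum m (fun o => B k o * (Yg c o t + -1 * Yg (par c) o t))); [ring|].
      apply fsum_ext; intros o _; rewrite !EY by auto; ring. }
  assert (HVs : signal K n z V).
  { apply signal_fsum; intros c Hc; apply signal_mult; [apply signal_cst|].
    apply signal_fsum; intros k Hk; apply signal_mult; [now apply signal_gen|].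
    apply signal_fsum; intros l Hl; apply signal_mult; [apply signal_cst|now apply signal_gen]. }
  assert (HV'v : vanishes V').
  { destruct (nonincreasing_limit V Hdec) as [l Hl].
    - intros t; rewrite HVq; apply fsum_nonneg; auto.
    - now apply (signal_deriv_vanishes K n z V V' l). }
  assert (Hev : forall c o, (c < K)%nat -> (o < m)%nat -> vanishes (e c o)).
  { intros c o Hc Ho; destruct (Nat.eq_dec c r) as [->|Hcr].
    - eapply vanishes_ext; [|exact vanishes_0]; intros t; symmetry.
      apply fsum_zero; intros; rewrite Hzr; ring.
    - specialize (Hkap' c Hc Hcr).
      apply (vanishes_sqr (e c o) (2 * c0 * kap c) (fun t => -1 * V' t)).
      + apply Rmult_lt_0_compat; lra.
      + intros t; specialize (HV'e t); specialize (HW t o Ho).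
        assert (kap c * (e c o t * e c o t) <= wnorm K kap (fun c => e c o t)).
        { apply (fsum_term_le K c (fun c => kap c * (e c o t * e c o t))); [|exact Hc].
          intros i _; apply Rmult_le_pos; [apply Hkap|apply Rle_0_sqr]. }
        assert (X : kap c * (e c o t * e c o t) <=
           fsum m (fun o => wnorm K kap (fun c => e c o t))) by lra.
        apply Rmult_le_compat_l with (r := 2 * c0) in X; lra.
      + now apply vanishes_scal. }
  assert (HYv : forall p o, (p < K)%nat -> (o < m)%nat -> vanishes (Y p o)).
  { intros p o Hp Ho.
    apply vanishes_ext with (fun t => a p * e p o t + -1 *
      fsum K (fun q => if Nat.eq_dec (par q) p then b q * e q o t else 0)).
    - intros t; destruct (Hsys o t) as [_ E]; rewrite E by exact Hp; ring.
    - apply vanishes_plus; apply vanishes_scal; auto.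
      apply (vanishes_fsum K (fun q t => if Nat.eq_dec (par q) p then b q * e q o t else 0)).
      intros q Hq; destruct (Nat.eq_dec (par q) p); [now apply vanishes_scal, Hev|exact vanishes_0]. }
  assert (Hall : forall c, (c < K)%nat ->
     forall v, vanishes (fun t => fsum n (fun k => v k * z c k t))).
  { intros c Hc; apply (observable_full n m A C); [exact Hobs| | |].
    - split; [|split].
      + intros v v' E; apply vanishes_ext; intros t.
        apply fsum_ext; intros i Hi; now rewrite E.
      + intros v v' s Hv Hv'.
        apply vanishes_ext with (fun t => fsum n (fun k => v k * z c k t)
          + s * fsum n (fun k => v' k * z c k t)).
        * intros t; rewrite <- fsum_scal, <- fsum_plus; apply fsum_ext; intros; ring.
        * now apply vanishes_plus, vanishes_scal.
      + apply vanishes_ext with (fun _ => 0); [|exact vanishes_0].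
        intros t; symmetry; apply fsum_zero; intros; ring.
    - intros o Ho; exact (Hev c o Hc Ho).
    - intros v Hv.
      pose (f' := fun t => fsum n (fun k => v k *
        (mv n A (fun l => z c l t) k - mv m B (fun o => Y c o t - Y (par c) o t) k))).
      assert (Hf' : vanishes f').
      { apply (signal_deriv_vanishes K n z (fun t => fsum n (fun k => v k * z c k t)) f' 0); auto.
        - apply signal_fsum; intros k Hk; apply signal_mult; [apply signal_cst|now apply signal_gen].
        - intros t; apply derivable_pt_lim_fsum; intros k Hk.
          now apply (derivable_pt_lim_scal (z c k)), Hz'.
        - eapply vanishes_ext; [|exact Hv]; intros; simpl; ring. }
      (* The derivative of [v . z_c] is [(A^T v) . z_c] minus a combination of coupling signals.
         Both the derivative and the coupling tend to 0, hence so does [(A^T v) . z_c]. *)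
      apply vanishes_ext with (fun t => f' t + fsum n (fun k => v k *
        fsum m (fun o => B k o * (Y c o t + -1 * Y (par c) o t)))).
      + intros t; unfold f'.
        rewrite <- (dot_mv_tr n n A v (fun k => z c k t)), <- fsum_plus.
        apply fsum_ext; intros k _.
        rewrite <- Rmult_plus_distr_l; f_equal.
        replace (fsum m (fun o => B k o * (Y c o t + -1 * Y (par c) o t)))
          with (mv m B (fun o => Y c o t - Y (par c) o t) k); [ring|].
        apply fsum_ext; intros; ring.
      + apply vanishes_plus; [exact Hf'|].
        apply (vanishes_fsum n (fun k t => v k *
          fsum m (fun o => B k o * (Y c o t + -1 * Y (par c) o t)))); intros k Hk.
        apply vanishes_scal.
        apply (vanishes_fsum m (fun o t => B k o * (Y c o t + -1 * Y (par c) o t))); intros o Ho.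
        apply vanishes_scal, vanishes_plus; [|apply vanishes_scal]; apply HYv; auto. }
  (* Differences telescope along the chain of parents, whose length is bounded by [rank]. *)
  assert (Hroot : forall h p k, (rank p < h)%nat -> (p < K)%nat -> (k < n)%nat ->
     vanishes (fun t => xi t p k - xi t r k)).
  { induction h as [|h IH]; intros p k Hh Hp Hk; [lia|].
    destruct (Nat.eq_dec p r) as [->|Hne].
    - apply vanishes_ext with (fun _ => 0); [intros; ring|exact vanishes_0].
    - apply vanishes_ext with (fun t => z p k t + (xi t (par p) k - xi t r k)).
      + intros t; unfold z; ring.
      + apply vanishes_plus.
        * eapply vanishes_ext; [|exact (Hall p Hp (idm k))].
          intros t; apply (dot_idm n k (fun k => z p k t) Hk).
        * apply IH; auto; specialize (Hrank p Hp Hne); lia. }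
  intros p q k Hp Hq Hk.
  apply vanishes_ext with (fun t => (xi t p k - xi t r k) + -1 * (xi t q k - xi t r k)).
  - intros; ring.
  - apply vanishes_plus; [|apply vanishes_scal]; eapply Hroot; eauto.
Qed.

(** * Trees *)

Lemma chain_app (e : nat -> nat -> Prop) (x : nat) (l l' : list nat) :
  chain e x (l ++ l') <-> chain e x l /\ chain e (last l x) l'.
Proof.
  revert x; induction l as [|y l IH]; intros x; [simpl; tauto|].
  change (e x y /\ chain e y (l ++ l') <->
          (e x y /\ chain e y l) /\ chain e (last (y :: l) x) l').
  rewrite IH; replace (last (y :: l) x) with (last l y); [tauto|].
  clear; revert x y; induction l as [|z l IH]; intros x y; [reflexivity|].
  transitivity (last l z); [symmetry; apply IH|]; transitivity (last (z :: l) x).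
  - apply IH.
  - reflexivity.
Qed.

(** When a step returns to a vertex already on the path, the path is truncated there. *)
Lemma reach_simple_path (e : nat -> nat -> Prop) (a b : nat) :
  reach e a b -> exists l, chain e a l /\ last l a = b /\ NoDup (a :: l).
Proof.
  intros H; induction H as [a|a b c H (l & Hc & Hl & Hn) E].
  - exists nil; repeat split; constructor; [intros []|constructor].
  - destruct (classic (In c (a :: l))) as [[->|Hin]|Hin].
    + exists nil; repeat split; constructor; [intros []|constructor].
    + apply in_split in Hin; destruct Hin as (l1 & l2 & ->).
      replace (l1 ++ c :: l2) with ((l1 ++ c :: nil) ++ l2) in Hc, Hn
        by (rewrite <- app_assoc; reflexivity).
      exists (l1 ++ c :: nil); repeat split.
      * now apply chain_app in Hc.
      * apply last_last.
      * rewrite app_comm_cons in Hn; now apply NoDup_app_remove_r in Hn.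
    + exists (l ++ c :: nil); repeat split.
      * apply chain_app; rewrite Hl; simpl; auto.
      * apply last_last.
      * rewrite app_comm_cons; apply NoDup_app; [exact Hn| |].
        -- constructor; [intros []|constructor].
        -- intros x Hx [->|[]]; now apply Hin.
Qed.

(** A simple [f]-path from [a] to [b] with two or more steps would close up through [e b a] to a
    cycle, so it is a single step. *)
Lemma acyclic_no_chord (N : nat) (e f : nat -> nat -> Prop) (a b : nat) :
  (forall x y, f x y -> e x y) -> (forall x y, e x y -> (x < N)%nat /\ (y < N)%nat) ->
  ~ has_cycle N e -> reach f a b -> e b a -> a <> b -> f a b.
Proof.
  intros Hfe HN Hac Hr Hba Hne.
  destruct (reach_simple_path f a b Hr) as (l & Hc & Hl & Hn).
  assert (Hce : forall x l, chain f x l -> chain e x l).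
  { intros x l'; revert x; induction l' as [|y l' IH]; intros x; simpl; intuition. }
  destruct l as [|y [|z l]]; [simpl in Hl; congruence| |].
  - simpl in Hl, Hc; subst; tauto.
  - exfalso; apply Hac; exists a, (y :: z :: l); split; [simpl; lia|].
    split; [exact Hn|split].
    + assert (Hv : forall x l, chain f x l -> forall v, In v l -> (v < N)%nat).
      { intros x l'; revert x; induction l' as [|u l' IH]; intros x Hx v Hv; [destruct Hv|].
        destruct Hx as [Hx Hx'], Hv as [<-|Hv]; [now apply Hfe, HN in Hx|].
        now apply (IH u). }
      intros v [<-|Hv']; [now apply HN in Hba|now apply (Hv a (y :: z :: l))].
    + apply chain_app; split; [now apply Hce|]; rewrite Hl; simpl; auto.
Qed.

Lemma finite_choice (N : nat) (P : nat -> nat -> Prop) :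
  (forall v, (v < N)%nat -> exists k, P v k) ->
  exists f, forall v, (v < N)%nat -> P v (f v).
Proof.
  induction N as [|N IH]; intros H; [exists (fun v => v); lia|].
  destruct IH as [f Hf]; [intros; apply H; lia|].
  destruct (H N ltac:(lia)) as [k Hk].
  exists (fun v => if Nat.eq_dec v N then k else f v); intros v Hv.
  destruct (Nat.eq_dec v N) as [->|]; [exact Hk|apply Hf; lia].
Qed.

Inductive depth (T : nat -> nat -> Prop) (r : nat) : nat -> nat -> Prop :=
| depth_root : depth T r r 0
| depth_child p c k : depth T r p k -> T p c -> depth T r c (S k).

(** The depth below the root serves as rank. Connectedness is undirected, so a path from the root
    may run against an arc; as incoming arcs are unique, such a step leads to the parent, one level
    up. *)
Lemma spanning_tree_parents (N : nat) (T : nat -> nat -> Prop) (r : nat) :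
  (r < N)%nat ->
  (forall i j, T i j -> (i < N)%nat /\ (j < N)%nat) ->
  (forall j, (j < N)%nat -> j <> r -> exists! i, T i j) ->
  (forall i, ~ T i r) ->
  (forall a b, (a < N)%nat -> (b < N)%nat -> reach (fun i j => T i j \/ T j i) a b) ->
  exists par rank, rooted_tree N r par rank /\
    forall i j, T i j <-> (j < N)%nat /\ j <> r /\ i = par j.
Proof.
  intros Hr HTN Huni Hroot Hreach.
  assert (Hpred : forall c k p, depth T r c k -> T p c -> exists k', k = S k' /\ depth T r p k').
  { intros c k p Hd HT; destruct Hd as [|p' c k Hd HT']; [now apply Hroot in HT|].
    exists k; split; [reflexivity|].
    destruct (Huni c) as (i & _ & Hi); [now apply HTN in HT|intros ->; now apply Hroot in HT|].
    now rewrite <- (Hi p HT), (Hi p' HT'). }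
  assert (Hdet : forall k c k', depth T r c k -> depth T r c k' -> k = k').
  { induction k as [|k IH]; intros c k' H H'.
    - inversion H; subst; inversion H'; subst; [reflexivity|].
      exfalso; eapply Hroot; eassumption.
    - inversion H as [|p c' k0 Hp HT]; subst.
      destruct (Hpred c k' p H' HT) as (k'' & -> & Hp'); f_equal; eauto. }
  assert (Hex : forall v, (v < N)%nat -> exists k, depth T r v k).
  { intros v Hv; specialize (Hreach r v Hr Hv).
    remember r as r0 eqn:Er in Hreach; induction Hreach as [a|a b c Hab IH E].
    - subst; exists 0%nat; constructor.
    - destruct E as [E|E].
      + destruct (IH Er ltac:(now apply HTN in E)) as [k Hk]; exists (S k).
        now apply depth_child with b.
      + destruct (IH Er ltac:(now apply HTN in E)) as [k Hk].
        destruct (Hpred b k c Hk E) as (k' & _ & Hk'); eauto. }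
  destruct (finite_choice N _ Hex) as [rank Hrank].
  destruct (finite_choice N (fun j i => (j = r -> i = r) /\ (j <> r -> T i j))) as [par Hpar].
  { intros j Hj; destruct (Nat.eq_dec j r) as [->|Hjr].
    - exists r; tauto.
    - destruct (Huni j Hj Hjr) as (i & Hi & _); exists i; tauto. }
  exists par, rank; split; [repeat split|].
  - exact Hr.
  - now apply Hpar.
  - intros p Hp; destruct (Nat.eq_dec p r) as [->|Hpr].
    + now rewrite (proj1 (Hpar r Hr) eq_refl).
    + destruct (Hpar p Hp) as [_ X]; now apply X, HTN in Hpr.
  - intros p Hp Hpr; destruct (Hpar p Hp) as [_ X]; specialize (X Hpr).
    destruct (Hpred p _ _ (Hrank p Hp) X) as (k & -> & Hk).
    rewrite (Hdet _ _ _ (Hrank (par p) ltac:(now apply HTN in X)) Hk); lia.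
  - intros i j; split.
    + intros HT; assert (Hj : (j < N)%nat) by now apply HTN in HT.
      assert (Hjr : j <> r) by (intros ->; now apply Hroot in HT).
      repeat split; auto; destruct (Huni j Hj Hjr) as (i' & _ & Hi').
      rewrite <- (Hi' i HT); apply Hi'; now apply Hpar.
    + intros (Hj & Hjr & ->); now apply Hpar.
Qed.

(** Two vertices adjacent in the underlying graph are also joined within the spanning tree;
    acyclicity forces their edge to be one of its arcs, up to direction. *)
Lemma assumption_A_rooted_tree (N : nat) (w : mat) :
  (forall i j, (i < N)%nat -> (j < N)%nat -> i <> j -> 0 <= w i j) ->
  assumption_A N w ->
  exists r par rank, rooted_tree N r par rank /\
    (forall p, (p < N)%nat -> p <> r -> 0 < w p (par p)) /\
    (forall p q, und_edge N w p q -> p = par q \/ q = par p).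
Proof.
  intros Hw [[_ Hac] (T & r & Hr & Harc & Huni & Hroot & [Hreach _])].
  destruct (spanning_tree_parents N T r Hr) as (par & rank & Htree & HT); auto.
  { intros i j HT; destruct (Harc i j HT) as (? & ? & _); auto. }
  exists r, par, rank; split; [exact Htree|split].
  - intros p Hp Hpr; destruct (Harc (par p) p) as (_ & _ & _ & H); [now apply HT|exact H].
  - intros p q (Hp & Hq & Hpq & Hpos).
    assert (X : T p q \/ T q p).
    { apply (acyclic_no_chord N (und_edge N w) (fun i j => T i j \/ T j i)); auto.
      - assert (Y : forall x y, T x y -> und_edge N w x y).
        { intros x y H; destruct (Harc x y H) as (Hx & Hy & Hxy & Hpos').
          repeat split; auto; specialize (Hw x y Hx Hy Hxy); lra. }
        intros x y [H|H]; [now apply Y|].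
        destruct (Y y x H) as (? & ? & ? & ?); repeat split; auto; lra.
      - intros x y (? & ? & _); auto.
      - repeat split; auto; lra. }
    destruct X as [X|X]; apply HT in X; tauto.
Qed.

(** Zero row sums rewrite the product as a sum of [lap p q * (x q - x p)], to which only the parent
    and the children of [p] contribute. *)
Lemma tree_laplacian_edge_system (K r : nat) (par rank : nat -> nat) (lap : mat) :
  rooted_tree K r par rank ->
  (forall p, (p < K)%nat -> fsum K (fun q => lap p q) = 0) ->
  (forall p q, (p < K)%nat -> (q < K)%nat -> p <> q -> lap p q <> 0 ->
     p = par q \/ q = par p) ->
  forall x, edge_system K r par (fun p => - lap p (par p)) (fun q => - lap (par q) q)
    (fun p => x p - x (par p)) (mv K lap x).
Proof.
  intros (Hr & Hpr & Hpar & Hrank) Hrow Hoff x; split; [rewrite Hpr; ring|].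
  intros p Hp.
  transitivity (fsum K (fun q => lap p q * (x q - x p))).
  { rewrite (fsum_ext K _ (fun q => lap p q * x q - x p * lap p q)) by (intros; ring).
    rewrite fsum_minus, fsum_scal, Hrow by exact Hp; unfold mv; ring. }
  rewrite (fsum_ext K _ (fun q =>
    (if Nat.eq_dec q (par p) then - lap p q * (x p - x q) else 0)
    - (if Nat.eq_dec (par q) p then - lap (par q) q * (x q - x (par q)) else 0))).
  - rewrite fsum_minus; f_equal.
    rewrite (fsum_single _ (par p)); [|now apply Hpar|].
    + destruct (Nat.eq_dec (par p) (par p)); [reflexivity|lia].
    + intros q _ Hq; destruct (Nat.eq_dec q (par p)); [lia|reflexivity].
  - intros q Hq; destruct (Nat.eq_dec p q) as [<-|Hpq].
    { destruct (Nat.eq_dec p (par p)), (Nat.eq_dec (par p) p) as [E|];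
        try rewrite E; ring. }
    destruct (Nat.eq_dec q (par p)) as [E1|E1], (Nat.eq_dec (par q) p) as [E2|E2].
    (* A vertex that is both parent and child of [p] would have rank both below and above that of
       [p]. *)
    + exfalso; destruct (Nat.eq_dec p r) as [->|Npr]; [congruence|].
      destruct (Nat.eq_dec q r) as [->|Nqr]; [congruence|].
      pose proof (Hrank p Hp Npr) as R1; pose proof (Hrank q Hq Nqr) as R2.
      rewrite <- E1 in R1; rewrite E2 in R2; lia.
    + ring.
    + rewrite E2; ring.
    + destruct (Req_dec (lap p q) 0) as [->|Hne]; [ring|].
      destruct (Hoff p q Hp Hq Hpq Hne); congruence.
Qed.

(** * The clustered network *)

Lemma fsum_Vmat (m q : nat) (f : nat -> R) :
  (q < S m)%nat ->
  fsum (S (S m)) (fun s => f s * Vmat (S (S m)) s q) =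
  if Nat.ltb q m then f q else f m + f (S m).
Proof.
  intros Hq; unfold Vmat; replace (S (S m) - 2)%nat with m by lia; simpl.
  destruct (Nat.ltb_spec m m); [lia|]; destruct (Nat.ltb_spec (S m) m); [lia|].
  destruct (Nat.ltb_spec q m) as [Hqm|Hqm].
  - destruct (Nat.eq_dec q m); [lia|].
    rewrite (fsum_single m q); [|exact Hqm|].
    + destruct (Nat.ltb_spec q m); [|lia]; destruct (Nat.eq_dec q q); [ring|lia].
    + intros i Hi Hiq; destruct (Nat.ltb_spec i m); [|lia].
      destruct (Nat.eq_dec i q); [lia|ring].
  - destruct (Nat.eq_dec q m); [|lia]; rewrite fsum_zero; [ring|].
    intros i Hi; destruct (Nat.ltb_spec i m); [|lia].
    destruct (Nat.eq_dec i q); [lia|ring].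
Qed.

(** The entries of [W] for the merged pair [i = m], [j = S m]: each endpoint is weighted by the arc
    that leaves it towards the other. *)
Definition weight_i (m : nat) (w : mat) : R := w (S m) m / (w m (S m) + w (S m) m).
Definition weight_j (m : nat) (w : mat) : R := w m (S m) / (w m (S m) + w (S m) m).

Lemma fsum_Wmat (m p : nat) (w : mat) (f : nat -> R) :
  (p < S m)%nat ->
  fsum (S (S m)) (fun s => mtr (Wmat (S (S m)) w) p s * f s) =
  if Nat.ltb p m then f p else weight_i m w * f m + weight_j m w * f (S m).
Proof.
  intros Hp; unfold mtr, Wmat; replace (S (S m) - 2)%nat with m by lia.
  replace (S (S m) - 1)%nat with (S m) by lia; cbn [fsum].
  destruct (Nat.ltb_spec m m); [lia|]; destruct (Nat.ltb_spec (S m) m); [lia|].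
  destruct (Nat.eq_dec m m); [|lia]; destruct (Nat.eq_dec (S m) m); [lia|].
  destruct (Nat.ltb_spec p m) as [Hpm|Hpm].
  - destruct (Nat.eq_dec p m); [lia|].
    rewrite (fsum_single m p); [|exact Hpm|].
    + destruct (Nat.ltb_spec p m); [|lia]; destruct (Nat.eq_dec p p); [ring|lia].
    + intros i Hi Hip; destruct (Nat.ltb_spec i m); [|lia].
      destruct (Nat.eq_dec i p); [lia|ring].
  - destruct (Nat.eq_dec p m); [|lia]; rewrite fsum_zero; [unfold weight_i, weight_j; ring|].
    intros i Hi; destruct (Nat.ltb_spec i m); [|lia].
    destruct (Nat.eq_dec i p); [lia|ring].
Qed.

Lemma laplacian_row_sum (N : nat) (w : mat) (i : nat) :
  (i < N)%nat -> fsum N (fun j => laplacian N w i j) = 0.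
Proof.
  intros Hi; unfold laplacian; set (D := fsum N (fun k => if Nat.eq_dec k i then 0 else w i k)).
  transitivity (fsum N (fun j => (if Nat.eq_dec j i then D else 0)
                                 - (if Nat.eq_dec j i then 0 else w i j))).
  - apply fsum_ext; intros j _; destruct (Nat.eq_dec i j), (Nat.eq_dec j i); lia || ring.
  - rewrite fsum_minus; fold D; rewrite (fsum_single _ i); [|exact Hi|].
    + destruct (Nat.eq_dec i i); [ring|lia].
    + intros j _ Hj; destruct (Nat.eq_dec j i); [lia|reflexivity].
Qed.

(** Each row of [V] has a single 1, so [V] sends the all-ones vector to the all-ones vector, which
    the Laplacian annihilates. *)
Lemma Lhat_row_sum (m : nat) (w : mat) (p : nat) :
  (p < S m)%nat -> fsum (S m) (fun q => Lhat (S (S m)) w p q) = 0.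
Proof.
  intros Hp; unfold Lhat, mmul at 1; rewrite fsum_swap.
  apply fsum_zero; intros s Hs; rewrite fsum_scal.
  replace (fsum (S m) _) with 0; [ring|].
  unfold mmul; rewrite fsum_swap; symmetry.
  rewrite <- (laplacian_row_sum (S (S m)) w s Hs); apply fsum_ext; intros l Hl.
  rewrite fsum_scal.
  (* [Nat.min l m] is the column of the 1 in row [l]: rows [m] and [S m] share column [m]. *)
  rewrite (fsum_single (S m) (Nat.min l m)); [|lia|].
  - unfold Vmat; replace (S (S m) - 2)%nat with m by lia.
    destruct (Nat.ltb_spec l m).
    + destruct (Nat.eq_dec l (Nat.min l m)); [ring|lia].
    + destruct (Nat.eq_dec (Nat.min l m) m); [ring|lia].
  - intros q Hq Hne; unfold Vmat; replace (S (S m) - 2)%nat with m by lia.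
    destruct (Nat.ltb_spec l m).
    + destruct (Nat.eq_dec l q); [lia|ring].
    + destruct (Nat.eq_dec q m); [lia|ring].
Qed.

(** For distinct [p] and [q] no diagonal entry of the Laplacian is involved, because [m] and [S m]
    collapse to the same index. *)
Lemma Lhat_off_diagonal (m : nat) (w : mat) (p q : nat) :
  (p < S m)%nat -> (q < S m)%nat -> p <> q ->
  - Lhat (S (S m)) w p q =
  if Nat.ltb p m then (if Nat.ltb q m then w p q else w p m + w p (S m))
  else weight_i m w * w m q + weight_j m w * w (S m) q.
Proof.
  intros Hp Hq Hpq; unfold Lhat, mmul at 1; rewrite fsum_Wmat by exact Hp.
  unfold mmul; rewrite !fsum_Vmat by exact Hq; unfold laplacian.
  destruct (Nat.ltb_spec p m), (Nat.ltb_spec q m); try lia;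
    repeat match goal with |- context [Nat.eq_dec ?a ?b] =>
      destruct (Nat.eq_dec a b); [lia|] end; ring.
Qed.

(* The edge [{m, m+1}] is contracted to the vertex [m]; the merged vertex inherits the
   parent of the upper endpoint [h], and [w_ji, w_ij] weight it positively. *)
Lemma contracted_tree (m r : nat) (w : mat) (par rank : nat -> nat) :
  let N := S (S m) in
  (forall i j, (i < N)%nat -> (j < N)%nat -> i <> j -> 0 <= w i j) ->
  rooted_tree N r par rank ->
  (forall p, (p < N)%nat -> p <> r -> 0 < w p (par p)) ->
  (forall p q, und_edge N w p q -> p = par q \/ q = par p) ->
  und_edge N w m (S m) ->
  exists r' par' rank', rooted_tree (S m) r' par' rank' /\
    (forall p, (p < S m)%nat -> p <> r' -> 0 < - Lhat N w p (par' p)) /\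
    (forall p q, (p < S m)%nat -> (q < S m)%nat -> p <> q -> 0 <= - Lhat N w p q) /\
    (forall p q, (p < S m)%nat -> (q < S m)%nat -> p <> q -> Lhat N w p q <> 0 ->
       p = par' q \/ q = par' p).
Proof.
  intros N Hw (Hr & Hpr & Hpar & Hrank) Hpos Hedge Hadj; unfold N in *; clear N.
  set (s := w m (S m) + w (S m) m).
  assert (Hs : 0 < s) by (destruct Hadj as (_ & _ & _ & H); exact H).
  assert (Hwi : 0 <= weight_i m w).
  { apply Rmult_le_pos; [apply Hw; lia|left; now apply Rinv_0_lt_compat]. }
  assert (Hwj : 0 <= weight_j m w).
  { apply Rmult_le_pos; [apply Hw; lia|left; now apply Rinv_0_lt_compat]. }
  assert (Hh : exists h lo, (h = m /\ lo = S m \/ h = S m /\ lo = m) /\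
    par lo = h /\ lo <> r).
  { destruct (Hedge m (S m) Hadj) as [E|E].
    - exists m, (S m); repeat split; auto; intros E1; rewrite <- E1 in Hpr; lia.
    - exists (S m), m; repeat split; auto; intros E1; rewrite <- E1 in Hpr; lia. }
  destruct Hh as (h & lo & Hhl & Hlo & Hlor).
  assert (Hrk : (rank h < rank lo)%nat) by (rewrite <- Hlo; apply Hrank; [lia|exact Hlor]).
  assert (Hw0 : 0 < w lo h) by (rewrite <- Hlo; apply Hpos; [lia|exact Hlor]).
  (* [phi] is the quotient map, sending [S m] to [m]; [t] lifts a cluster to its vertex closest to
     the root, which is [h] for the merged one. The parent of a cluster is the cluster of the parent
     of its top vertex. *)
  pose (t := fun c => if Nat.eq_dec c m then h else c).
  pose (phi := fun x => Nat.min x m).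
  pose (par' := fun c => phi (par (t c))).
  assert (Ht : forall c, (c < S m)%nat -> (t c < S (S m))%nat /\ phi (t c) = c).
  { intros c Hc; unfold t, phi; destruct (Nat.eq_dec c m); lia. }
  assert (Htphi : forall x, (x < S (S m))%nat -> x <> lo -> t (phi x) = x).
  { intros x Hx Hxl; unfold t, phi; destruct (Nat.eq_dec (Nat.min x m) m); lia. }
  assert (Htlo : t (phi lo) = h).
  { unfold t, phi; destruct (Nat.eq_dec (Nat.min lo m) m); lia. }
  assert (Hphi : phi h = phi lo) by (unfold phi; lia).
  assert (Htr : forall c, (c < S m)%nat -> c <> phi r -> t c <> r).
  { intros c Hc Hcr E; apply Hcr; rewrite <- E; symmetry; now apply Ht. }
  assert (Hlift : forall x y, (y < S (S m))%nat -> x = par y -> phi x <> phi y ->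
     phi x = par' (phi y)).
  { intros x y Hy -> Hne; unfold par'; destruct (Nat.eq_dec y lo) as [->|Hyl].
    - exfalso; apply Hne; now rewrite Hlo.
    - now rewrite Htphi. }
  assert (Hund : forall x y, (x < S (S m))%nat -> (y < S (S m))%nat ->
     phi x <> phi y -> w x y <> 0 -> phi x = par' (phi y) \/ phi y = par' (phi x)).
  { intros x y Hx Hy Hne Hwxy; assert (Hxy : x <> y) by (intros ->; now apply Hne).
    assert (E : und_edge (S (S m)) w x y).
    { repeat split; auto.
      pose proof (Hw x y Hx Hy Hxy); pose proof (Hw y x Hy Hx ltac:(auto)); lra. }
    destruct (Hedge x y E) as [E'|E']; [left|right]; apply Hlift; auto. }
  assert (Hphi_lt : forall x, (x < m)%nat -> phi x = x) by (intros; unfold phi; lia).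
  assert (Hphi_m : phi m = m /\ phi (S m) = m) by (unfold phi; lia).
  destruct Hphi_m as [Hphi_m Hphi_m'].
  exists (phi r), par', (fun c => rank (t c)).
  assert (Hpar'_ne : forall c, (c < S m)%nat -> c <> phi r ->
     (rank (t (par' c)) < rank (t c))%nat).
  { intros c Hc Hcr; destruct (Ht c Hc) as [Htc _].
    specialize (Hrank (t c) Htc (Htr c Hc Hcr)); unfold par'.
    (* If that parent is the lower endpoint, the top of its cluster is [h], of still smaller
       rank. *)
    destruct (Nat.eq_dec (par (t c)) lo) as [E|E].
    - rewrite E in *; rewrite Htlo; lia.
    - rewrite Htphi; auto. }
  repeat split.
  - unfold phi; lia.
  - unfold par'; rewrite Htphi; [now rewrite Hpr|exact Hr|auto].
  - intros p Hp; unfold par', phi; lia.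
  - exact Hpar'_ne.
  - intros p Hp Hpr'.
    assert (Hne : p <> par' p).
    { intros E; specialize (Hpar'_ne p Hp Hpr'); rewrite <- E in Hpar'_ne; lia. }
    destruct (Ht p Hp) as [Htp Hphip]; specialize (Hpos (t p) Htp (Htr p Hp Hpr')).
    specialize (Hpar (t p) Htp).
    rewrite Lhat_off_diagonal; [|exact Hp|unfold par', phi; lia|exact Hne].
    unfold par' in *; set (g := par (t p)) in *.
    destruct (Nat.ltb_spec p m) as [Hpm|Hpm].
    + assert (Etp : t p = p) by (unfold t; destruct (Nat.eq_dec p m); lia).
      rewrite Etp in Hpos.
      destruct (Nat.ltb_spec (phi g) m) as [Hg|Hg].
      * unfold phi in *; rewrite Nat.min_l by lia; exact Hpos.
      * pose proof (Hw p m ltac:(lia) ltac:(lia) ltac:(lia)).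
        pose proof (Hw p (S m) ltac:(lia) ltac:(lia) ltac:(lia)).
        assert (Hgm : g = m \/ g = S m) by (unfold phi in Hg; lia).
        destruct Hgm as [E|E]; rewrite E in Hpos; lra.
    + assert (Epm : p = m) by lia; subst p.
      assert (Et : t m = h) by (unfold t; destruct (Nat.eq_dec m m); lia).
      assert (Hg : (g < m)%nat) by (unfold phi in Hne; lia).
      rewrite Hphi_lt by exact Hg; rewrite Et in Hpos.
      pose proof (Hw m g ltac:(lia) ltac:(lia) ltac:(lia)).
      pose proof (Hw (S m) g ltac:(lia) ltac:(lia) ltac:(lia)).
      (* The arc into [h] from its parent has positive weight, and the coefficient of [h] in [W] is
         a positive multiple of [w lo h > 0]. *)
      destruct Hhl as [[Eh El]|[Eh El]]; rewrite Eh, ?El in *.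
      * assert (0 < weight_i m w) by (apply Rdiv_lt_0_compat; assumption).
        apply Rplus_lt_le_0_compat; [apply Rmult_lt_0_compat|apply Rmult_le_pos]; assumption.
      * assert (0 < weight_j m w) by (apply Rdiv_lt_0_compat; assumption).
        apply Rplus_le_lt_0_compat; [apply Rmult_le_pos|apply Rmult_lt_0_compat]; assumption.
  - intros p q Hp Hq Hpq; rewrite Lhat_off_diagonal by assumption.
    destruct (Nat.ltb_spec p m), (Nat.ltb_spec q m); try lia;
      try apply Rplus_le_le_0_compat; try apply Rmult_le_pos; auto; apply Hw; lia.
  - intros p q Hp Hq Hpq Hne.
    assert (Hne' : - Lhat (S (S m)) w p q <> 0) by lra.
    rewrite Lhat_off_diagonal in Hne' by assumption.
    (* A nonzero entry comes from a nonzero weight between members of the two clusters, hence from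
       an edge of the original tree. *)
    assert (Hfib : exists x y, (x < S (S m))%nat /\ (y < S (S m))%nat /\
      phi x = p /\ phi y = q /\ w x y <> 0).
    { destruct (Nat.ltb_spec p m) as [Hpm|Hpm], (Nat.ltb_spec q m) as [Hqm|Hqm]; try lia.
      - exists p, q; rewrite !Hphi_lt by assumption; repeat split; auto; lia.
      - assert (q = m) by lia; subst q.
        destruct (Req_dec (w p m) 0) as [E|E].
        + exists p, (S m); rewrite Hphi_lt by assumption; repeat split; auto; try lia.
          intros E'; apply Hne'; rewrite E, E'; ring.
        + exists p, m; rewrite Hphi_lt by assumption; repeat split; auto; lia.
      - assert (p = m) by lia; subst p.
        destruct (Req_dec (w m q) 0) as [E|E].
        + exists (S m), q; rewrite (Hphi_lt q) by assumption; repeat split; auto; try lia.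
          intros E'; apply Hne'; rewrite E, E'; ring.
        + exists m, q; rewrite (Hphi_lt q) by assumption; repeat split; auto; lia. }
    destruct Hfib as (x & y & Hx & Hy & <- & <- & Hxy); now apply Hund.
Qed.

Theorem theorem3
  (n m nbar mbar : nat) (Q J Rm B : mat) (w G : mat)
  (HQ : pos_def n Q) (HJ : skew n J) (HR : pos_semidef n Rm)
  (Hmin : minimal_realization n m m
            (mmul n (msub J Rm) Q) B (mmul n (mtr B) Q))
  (Hnbar : (3 <= nbar)%nat)
  (Hw : forall i j, (i < nbar)%nat -> (j < nbar)%nat -> i <> j -> 0 <= w i j)
  (HA : assumption_A nbar w)
  (Hadj : und_edge nbar w (nbar - 2) (nbar - 1))
  (u : R -> nat -> nat -> R) (Hu : forall t a b, u t a b = 0)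
  (xi : R -> nat -> nat -> R)
  (Hsol : forall t p k, (p < nbar - 1)%nat -> (k < n)%nat ->
     derivable_pt_lim (fun s => xi s p k) t
       (fsum n (fun l => mmul n (msub J Rm) Q k l * xi t p l)
        - fsum (nbar - 1) (fun q => Lhat nbar w p q *
             fsum n (fun l => mmul m B (mmul n (mtr B) Q) k l * xi t q l))
        + fsum mbar (fun a => Ghat nbar w G p a *
             fsum m (fun b => B k b * u t a b)))) :
  forall p q k, (p < nbar - 1)%nat -> (q < nbar - 1)%nat -> (k < n)%nat ->
    forall eps, eps > 0 -> exists T, forall t, t >= T ->
      Rabs (xi t p k - xi t q k) < eps.
Proof.
  (* With [nbar = mu + 2] the clustered pair is [mu] and [S mu], merged into the last index [mu] of
     the reduced network. *)
  destruct nbar as [|[|mu]]; [lia|lia|].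
  replace (S (S mu) - 2)%nat with mu in Hadj by lia.
  replace (S (S mu) - 1)%nat with (S mu) in * by lia.
  destruct (assumption_A_rooted_tree _ w Hw HA) as (r & par & rank & Htree & Hpos & Hedge).
  destruct (contracted_tree mu r w par rank Hw Htree Hpos Hedge Hadj)
    as (r' & par' & rank' & Htree' & Hpos' & Hnn & Hoff).
  pose proof Htree' as (Hr' & Hpr' & Hpar' & Hrank').
  apply (tree_synchronization n m (S mu) r' Q J Rm B (Lhat (S (S mu)) w) par' rank'
    (fun p => - Lhat (S (S mu)) w p (par' p)) (fun q => - Lhat (S (S mu)) w (par' q) q));
    auto.
  - apply Hmin.
  - intros p Hp Hpr; apply Hnn; auto.
    intros E; specialize (Hrank' p Hp Hpr); rewrite E in Hrank'; lia.
  - apply (tree_laplacian_edge_system (S mu) r' par' rank'); auto.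
    intros; now apply Lhat_row_sum.
  - intros t p k Hp Hk; specialize (Hsol t p k Hp Hk).
    rewrite (fsum_zero mbar) in Hsol.
    2:{ intros c _; rewrite fsum_zero; [ring|]; intros; rewrite Hu; ring. }
    rewrite Rplus_0_r in Hsol.
    (* The Kronecker product of [Lhat] and [B C] acts as [B] on the [Lhat]-combination of the
       outputs, the form that [tree_synchronization] expects. *)
    replace (mv m B _ k) with (fsum (S mu) (fun q => Lhat (S (S mu)) w p q *
      fsum n (fun l => mmul m B (mmul n (mtr B) Q) k l * xi t q l))); [exact Hsol|].
    transitivity (fsum (S mu) (fun q => fsum m (fun c =>
      Lhat (S (S mu)) w p q * (B k c * mv n (mmul n (mtr B) Q) (xi t q) c)))).
    + apply fsum_ext; intros q _; rewrite fsum_scal; f_equal; apply mv_mmul.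
    + rewrite fsum_swap; apply fsum_ext; intros c _; unfold mv at 2; rewrite <- fsum_scal.
      apply fsum_ext; intros; ring.
Qed.
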